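(* There exists a real number $\varepsilon>0$ such that the following holds for every finite field $\mathbb{F}_q$. Let $G=\mathrm{SL}_2(\mathbb{F}_q)$ and let $A\subseteq G$ be a generating set of $G$. Then $$|A\cdot A\cdot A|\ \ge\ \min\{|A|^{1+\varepsilon},\,|G|\}.$$ The same assertion holds with $G=\mathrm{PSL}_2(\mathbb{F}_q)$ in place of $\mathrm{SL}_2(\mathbb{F}_q)$.
   Context: For a subset $A$ of a group, $A\cdot A\cdot A=\{a_1a_2a_3 : a_1,a_2,a_3\in A\}$. The constant $\varepsilon$ is absolute (it does not depend on $q$ or $A$).
   Formalization: The formal theorem assumes q ≥ 4, because for q = 2 and q = 3 the claim is false: the three transpositions generate SL_2(F_2) = S_3 with |AAA| = |A| = 3, and a nontrivial coset of the commutator subgroup is a counterexample for q = 3. *)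

(* Defs.v *)
From HB Require Import structures.
From mathcomp Require Import all_boot all_order all_algebra all_fingroup all_solvable.
From mathcomp Require Import reals exp.

Set Implicit Arguments.
Unset Strict Implicit.
Unset Printing Implicit Defensive.

Import Order.TTheory GRing.Theory Num.Theory GroupScope.
Local Open Scope ring_scope.

Definition SL2 (F : finFieldType) : {set {'GL_2[F]}} :=
  [set g : {'GL_2[F]} | \det (GLval g) == 1].

Lemma SL2_group_set (F : finFieldType) : group_set (SL2 F).
Proof.
apply/group_setP; split=> [|g h]; first by rewrite inE GL_1E det1.
by rewrite !inE GL_ME => /eqP dg /eqP dh; rewrite det_mulmx dg dh mulr1.
Qed.

Canonical SL2_group (F : finFieldType) : {group {'GL_2[F]}} :=
  Group (SL2_group_set F).

Definition PSL2 (F : finFieldType) : {group coset_of 'Z(SL2 F)} :=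
  (SL2 F / 'Z(SL2 F))%G.

(* SL2 F and PSL2 F are perfect exactly when #|F| > 3.  For #|F| = 2 or 3 the   *)
(* tripling inequality is false, for every exponent > 1: if D is the commutator *)
(* subgroup and g \notin D, then A = g *: D generates the whole group, while    *)
(* A * A * A = g ^+ 3 *: D has the same cardinal as A (2 or 3 times too small). *)

(* Main.v *)
(* Let A be a generating set with |A^3| <= K|A|. By Ruzsa's triangle inequality the symmetric hull B
   of A has small products B^k of any bounded length, at a cost polynomial in K. A special
   case of the Larsen-Pink inequality bounds |B^k meets C| by K^O(1) |B|^(2/3) for a conjugacy class C
   of elements of trace t with t <> 0 and t^2 <> 4: the fibres of (x, y, z) |-> (xy, xz) on C^3 are
   intersections of a quadric with an affine line, up to degenerate triples lying in a common Borel
   subgroup. By orbit-stabilizer, B^2 then contains at least K^-O(1) |B|^(1/3) elements of the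
   centralizer of any such element of B^6, so that the set of elements with such a rich
   centralizer is invariant under conjugation by B, hence by the whole group. As distinct
   centralizers meet in the center, this gives |B| >= K^-O(1) q^3, and since nontrivial
   representations of SL2 have degree at least (q-1)/2, Gowers' quasirandomness argument shows that
   A^3 is the whole group unless |A| is at most a power of K. *)

Require Import Defs.
From HB Require Import structures.
From mathcomp Require Import all_boot all_order all_algebra all_fingroup all_solvable.
From mathcomp Require Import all_field all_character spectral sesquilinear.
From mathcomp Require Import reals exp.
From mathcomp Require Import zify ring lra.

Set Implicit Arguments.
Unset Strict Implicit.
Unset Printing Implicit Defensive.

Import Order.TTheory GRing.Theory Num.Theory.
Local Open Scope ring_scope.

(** * Small tripling *)

Section Tripling.
Import GroupScope.
Local Open Scope nat_scope.
Variable gT : finGroupType.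
Implicit Types (A B X Y Z : {set gT}) (K n : nat).

(** All geometry is done over [F] itself, with 2x2 matrices as vectors of a 4-dimensional space. The
    conditions on t have different uses: t <> 0 makes the trace form independent of two other forms
    that vanish at the inverse of the first coordinate, which bounds generic fibres by two points;
    t^2 <> 4 rules out scalar matrices, so that centralizers are commutative and eigenlines few.
    Degenerate triples are rare because, up to powers of K, only |B|^(1/3) elements of a bounded
    power of B fix a given vector. The obstacle to invariance is that conjugates of h by long words
    leave every bounded power of B; but the size condition depends only on the centralizer, which
    again contains a short element. Two bounds close the argument: |G|^3 <= M q^3 |A|^2 and q |A|^3
    <= 4 |G|^3, with M a constant times a power of K; they give |A| <= 4 M q^2, and |G| >= q^3 / 2
    then bounds q. The outcome |A| <= c K^C says nothing about small A with K near 1. There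
    [strict_growth] supplies one extra element, and this is where perfectness enters. *)

Lemma ruzsa_triangle X Y Z :
  #|(X * Z)%g| * #|Y| <= #|(X * Y^-1)%g| * #|(Y * Z)%g|.
Proof.
have /fin_all_exists[f fP] w : exists p : gT * gT, w \in (X * Z)%g ->
    [/\ p.1 \in X, p.2 \in Z & w = (p.1 * p.2)%g].
  case: (boolP (w \in X * Z)%g) => [/mulsgP[x z Xx Zz ->]|_]; last by exists (1, 1)%g.
  by exists (x, z).
(* With a fixed factorization [w = x * z], send [(w, y)] to [(x * y^-1, y * z)]: the product of the
   two coordinates gives back [w], hence [x] and [z], and then [y]. *)
rewrite -!cardsX; pose h (p : gT * gT) := ((f p.1).1 * p.2^-1, p.2 * (f p.1).2)%g.
rewrite -(card_in_imset (f := h)).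
  apply/subset_leq_card/subsetP => _ /imsetP[[w y] /setXP[/= /fP[Xx Zz _] Yy] ->].
  by rewrite inE /= !mem_mulg ?memV_invg.
move=> [w y] [w' y'] /setXP[/= Xw Yy] /setXP[/= Xw' Yy'] [e1 e2].
have ew : w = w'.
  have [_ _ {1}->] := fP w Xw; have [_ _ {1}->] := fP w' Xw'.
  have /(congr1 (mulg^~ (y' * (f w').2)%g)) := e1; rewrite -{1}e2 /=.
  by rewrite !mulgA !mulgKV.
congr (_, _) => //; move: e2; rewrite ew; exact: mulIg.
Qed.

Lemma leq_card_mull X Y x : x \in X -> #|Y| <= #|(X * Y)%g|.
Proof. by move=> Xx; rewrite -(card_lcoset Y x) subset_leq_card ?mulSg ?sub1set. Qed.

Lemma leq_card_mulr X Y y : y \in Y -> #|X| <= #|(X * Y)%g|.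
Proof. by move=> Yy; rewrite -(card_rcoset X y) subset_leq_card ?mulgS ?sub1set. Qed.

Definition sym_hull A : {set gT} := 1%g |: (A :|: A^-1)%g.

Lemma sym_hullV A : (sym_hull A)^-1%g = sym_hull A.
Proof. by apply/setP => x; rewrite !inE invg_eq1 invgK [(x \in A) || _]orbC. Qed.

Lemma sym_hull1 A : 1%g \in sym_hull A. Proof. by rewrite !inE eqxx. Qed.

Lemma sub_sym_hull A : A \subset sym_hull A.
Proof. by apply/subsetP => x Ax; rewrite !inE Ax orbT. Qed.

Lemma gen_sym_hull A : <<sym_hull A>> = <<A>>.
Proof.
apply/eqP; rewrite eqEsubset (genS (sub_sym_hull A)) andbT gen_subG.
apply/subsetP => x; rewrite !inE => /or3P[/eqP->|Ax|Ax]; first exact: group1.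
  exact: mem_gen.
by rewrite -groupV mem_gen.
Qed.

Lemma card_mul_sym_hull A X Y m :
    (forall S, S \in [:: 1%g; A; A^-1%g] -> #|(X * S * Y)%g| <= m) ->
  #|(X * sym_hull A * Y)%g| <= 3 * m.
Proof.
move=> mP; rewrite /sym_hull !mulgU !mulUg.
apply: leq_trans (leq_card_setU _ _) _; rewrite mulSn mul2n -addnn.
apply: leq_add; first by rewrite mP ?mem_head.
by apply: leq_trans (leq_card_setU _ _) _; rewrite leq_add ?mP ?inE ?eqxx ?orbT.
Qed.

(** Expanding the factors gives 27 words in [1], [A], [A^-1]. Ruzsa's inequality bounds the mixed
    ones; the worst, [A * A^-1 * A] and its inverse, cost [K ^ 3]. *)
Lemma card_sym_hull_tripling A K : A != set0 ->
  #|(A * A * A)%g| <= K * #|A| ->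
  #|(sym_hull A * sym_hull A * sym_hull A)%g| <= 27 * K ^ 3 * #|A|.
Proof.
case/set0Pn => a Aa tripA; set n := #|A| in tripA *.
have n_gt0 : 0 < n by apply/card_gt0P; exists a.
have cVA : #|A^-1%g| = n by rewrite card_invg.
have K_gt0 : 0 < K.
  rewrite lt0n; apply: contraTneq tripA => ->; rewrite -ltnNge mul0n.
  by apply/card_gt0P; exists (a * a * a)%g; rewrite !mem_mulg.
have K1 : K * n <= K ^ 3 * n by rewrite leq_mul2r (@leq_pexp2l K 1 3) ?orbT.
have K2 : K ^ 2 * n <= K ^ 3 * n by rewrite leq_mul2r (@leq_pexp2l K 2 3) ?orbT.
have VX X Y : #|(X^-1 * Y^-1)%g| = #|(Y * X)%g| by rewrite -invMg card_invg.
have cAAA : #|(A * A * A)%g| <= K ^ 3 * n by apply: leq_trans K1.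
have cAA : #|(A * A)%g| <= K * n by apply: leq_trans tripA; apply: leq_card_mulr Aa.
have tAAV : #|(A * A * A^-1)%g| <= K ^ 2 * n.
  have := ruzsa_triangle (A * A)%g A^-1%g A^-1%g; rewrite cVA invgK VX => le_n.
  rewrite -(leq_pmul2r n_gt0); apply: leq_trans le_n _.
  by apply: leq_trans (leq_mul tripA cAA) _; lia.
have tVAA : #|(A^-1 * (A * A))%g| <= K ^ 2 * n.
  rewrite -(leq_pmul2r (m := n)) //.
  apply: leq_trans (ruzsa_triangle _ A _) _.
  by rewrite VX mulgA; apply: leq_trans (leq_mul cAA tripA) _; lia.
have VAVV : #|(A * (A^-1 * A^-1))%g| = #|(A * A * A^-1)%g|.
  by rewrite -card_invg !invMg !invgK.
have tAVA : #|(A * A^-1 * A)%g| <= K ^ 3 * n.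
  rewrite -(leq_pmul2r (m := n)) //.
  apply: leq_trans (ruzsa_triangle _ A _) _; rewrite -mulgA VAVV.
  apply: leq_trans (leq_mul tAAV cAA) _; lia.
have tVAV : #|(A^-1 * A * A^-1)%g| <= K ^ 3 * n.
  by rewrite -card_invg !invMg !invgK mulgA.
have tVVA : #|(A^-1 * A^-1 * A)%g| <= K ^ 2 * n.
  by rewrite -card_invg !invMg !invgK.
have tVVV : #|(A^-1 * A^-1 * A^-1)%g| <= K * n by rewrite -card_invg !invMg !invgK mulgA.
have cA : n <= K ^ 3 * n by rewrite leq_pmull // expn_gt0 K_gt0.
have cAV : #|(A * A^-1)%g| <= K ^ 2 * n.
  by apply: leq_trans tAAV; rewrite -mulgA; apply: leq_card_mull Aa.
have cVA2 : #|(A^-1 * A)%g| <= K ^ 2 * n.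
  by apply: leq_trans tVAA; rewrite mulgA; apply: leq_card_mulr Aa.
have cVV : #|(A^-1 * A^-1)%g| <= K * n by rewrite VX.
have c1 : #|[1 gT]| <= n by rewrite cards1.
suff D S1 S2 S3 : S1 \in [:: 1%g; A; A^-1%g] -> S2 \in [:: 1%g; A; A^-1%g] ->
    S3 \in [:: 1%g; A; A^-1%g] -> #|(S1 * S2 * S3)%g| <= K ^ 3 * n.
  rewrite -mulnA; move: (K ^ 3 * n) D => m D; rewrite (_ : 27 = 3 * (3 * 3)) // -!mulnA.
  rewrite -[(_ * sym_hull A)%g]mulg1; apply: card_mul_sym_hull => S3 S3P; rewrite mulg1.
  apply: card_mul_sym_hull => S2 S2P; rewrite -[sym_hull A]mul1g -mulgA.
  by apply: card_mul_sym_hull => S1 S1P; rewrite mul1g mulgA; exact: D.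
rewrite mulgA in tVAA; rewrite mulgA in VAVV.
rewrite !inE; case/or3P=> /eqP->; case/or3P=> /eqP->; case/or3P=> /eqP->;
  rewrite ?mul1g ?mulg1 ?mulgA ?VAVV ?cVA //;
  first [exact: leq_trans K1 | exact: leq_trans K2 | exact: leq_trans cA].
Qed.

(** Ruzsa's inequality with middle set [B] bounds [B ^+ k.+3] through [B ^+ 3] and [B ^+ k.+2], so
    each further factor costs one [K']. *)
Lemma leq_card_expg_sym (B : {set gT}) K' k :
    1%g \in B -> B^-1%g = B -> #|(B * B * B)%g| <= K' * #|B| ->
  #|(B ^+ k.+2)%g| <= K' ^ k.+1 * #|B|.
Proof.
move=> B1 BV trip; elim: k => [|k IHk].
  by rewrite expn1; apply: leq_trans trip; rewrite expgS expg1; apply: leq_card_mulr B1.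
have B_gt0 : 0 < #|B| by apply/card_gt0P; exists 1%g.
rewrite -(leq_pmul2r B_gt0) (_ : k.+3 = 2 + k.+1) // expgnDr.
apply: leq_trans (ruzsa_triangle _ B _) _; rewrite BV -expgS -expgSr.
rewrite (expnS _ k.+1) -mulnA mulnAC -mulnA mulnC mulnA.
have -> : (B ^+ 3 = B * B * B)%g by rewrite !expgS expg0 mulg1 mulgA.
rewrite mulnC; apply: leq_trans (leq_mul trip IHk) _; lia.
Qed.

End Tripling.

(** * Coordinates on SL2 *)

(* mG is SL_2(F) inside an ambient group mT that plays the role of GL_2(F); the value
   of sl2 a b c d is meaningful only if a * d - b * c = 1. *)
Record sl2_model (F : finFieldType) := SL2Model {
  mT :> finGroupType;
  mG : {group mT};
  e11 : mT -> F; e12 : mT -> F; e21 : mT -> F; e22 : mT -> F;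
  sl2 : F -> F -> F -> F -> mT;
  GL2_eqP : forall g h : mT,
    e11 g = e11 h -> e12 g = e12 h -> e21 g = e21 h -> e22 g = e22 h -> g = h;
  entryM : forall g h : mT,
    [/\ e11 (g * h)%g = e11 g * e11 h + e12 g * e21 h,
        e12 (g * h)%g = e11 g * e12 h + e12 g * e22 h,
        e21 (g * h)%g = e21 g * e11 h + e22 g * e21 h &
        e22 (g * h)%g = e21 g * e12 h + e22 g * e22 h];
  entry1 : [/\ e11 1%g = 1, e12 1%g = 0, e21 1%g = 0 & e22 1%g = 1];
  SL2P : forall g : mT, reflect (e11 g * e22 g - e12 g * e21 g = 1) (g \in mG);
  entry_sl2 : forall a b c d : F, a * d - b * c = 1 ->
    [/\ e11 (sl2 a b c d) = a, e12 (sl2 a b c d) = b,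
        e21 (sl2 a b c d) = c & e22 (sl2 a b c d) = d] }.
Arguments e11 {F s}.
Arguments e12 {F s}.
Arguments e21 {F s}.
Arguments e22 {F s}.
Arguments sl2 {F s}.
Arguments SL2P {F s g}.

Section Entries.
Variables (F : finFieldType) (S : sl2_model F).
Implicit Types (g h x y : S) (a b c d t : F).

Definition tr g : F := e11 g + e22 g.

Lemma e11M g h : e11 (g * h)%g = e11 g * e11 h + e12 g * e21 h.
Proof. by case: (entryM g h). Qed.
Lemma e12M g h : e12 (g * h)%g = e11 g * e12 h + e12 g * e22 h.
Proof. by case: (entryM g h). Qed.
Lemma e21M g h : e21 (g * h)%g = e21 g * e11 h + e22 g * e21 h.
Proof. by case: (entryM g h). Qed.
Lemma e22M g h : e22 (g * h)%g = e21 g * e12 h + e22 g * e22 h.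
Proof. by case: (entryM g h). Qed.
Definition entM := (e11M, e12M, e21M, e22M).

Lemma ent1 : (e11 (1%g : S) = 1) * (e12 (1%g : S) = 0)
  * (e21 (1%g : S) = 0) * (e22 (1%g : S) = 1).
Proof. by case: (entry1 S). Qed.

Lemma ent_sl2 a b c d : a * d - b * c = 1 ->
  (e11 (sl2 a b c d : S) = a) * (e12 (sl2 a b c d : S) = b) *
  (e21 (sl2 a b c d : S) = c) * (e22 (sl2 a b c d : S) = d).
Proof. by move=> /(entry_sl2 S)[]. Qed.

Lemma sl2_in a b c d : a * d - b * c = 1 -> (sl2 a b c d : S) \in mG S.
Proof. by move=> det1; apply/SL2P; rewrite !ent_sl2. Qed.

Lemma entV g : g \in mG S ->
  (e11 g^-1%g = e22 g) * (e12 g^-1%g = - e12 g) *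
  (e21 g^-1%g = - e21 g) * (e22 g^-1%g = e11 g).
Proof.
move=> /SL2P dg; have dh : e22 g * e11 g - - e12 g * - e21 g = 1 by rewrite mulrNN mulrC.
suff -> : (g^-1 = sl2 (e22 g) (- e12 g) (- e21 g) (e11 g))%g by rewrite !ent_sl2.
apply: (mulgI g); rewrite mulgV.
by apply: GL2_eqP; rewrite entM !ent_sl2 // ent1 -?dg; ring.
Qed.

End Entries.

(** In a finite group [<<B>>] is a power of [1 |: B], so the induction runs over the length of
    positive words. *)
Lemma gen_sym_ind (gT : finGroupType) (B : {set gT}) (P : gT -> Prop) :
    P 1%g -> (forall b x, b \in B -> P x -> P (b * x)%g) ->
  forall x, x \in <<B>>%g -> P x.
Proof.
move=> P1 PM x; have [n ->] := gen_expgs B.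
elim: n x => [|n IHn] x; first by rewrite expg0 => /set1P->.
rewrite expgS => /mulsgP[b y]; rewrite !inE => /orP[/eqP-> /IHn|Bb /IHn Py ->].
  by move=> Py ->; rewrite mul1g.
exact: PM.
Qed.

(** * Action on the plane: unipotent elements and irreducibility *)

Section Vectors.
Variables (F : finFieldType) (S : sl2_model F).
Implicit Types (g h x y : S) (a b c d t : F) (v w : F * F).

Definition act g v : F * F := (e11 g * v.1 + e12 g * v.2, e21 g * v.1 + e22 g * v.2).
Definition cross v w : F := v.1 * w.2 - v.2 * w.1.

Lemma act1 v : act 1%g v = v.
Proof. by case: v => a b; rewrite /act !ent1 !(mul1r, mul0r, addr0, add0r). Qed.

Lemma actM g h v : act (g * h)%g v = act g (act h v).
Proof. by rewrite /act !entM /=; congr (_, _); ring. Qed.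

Lemma cross_act g v w : g \in mG S -> cross (act g v) (act g w) = cross v w.
Proof. by move=> /SL2P dg; rewrite /cross -[RHS]mul1r -dg /=; ring. Qed.

Lemma act_inj2 g h v w : cross v w != 0 ->
  act g v = act h v -> act g w = act h w -> g = h.
Proof.
move=> vw0 [v1 v2] [w1 w2].
apply: GL2_eqP; apply: (mulIf vw0); rewrite /cross.
- transitivity ((e11 g * v.1 + e12 g * v.2) * w.2 - (e11 g * w.1 + e12 g * w.2) * v.2).
    by ring.
  by rewrite v1 w1; ring.
- transitivity ((e11 g * w.1 + e12 g * w.2) * v.1 - (e11 g * v.1 + e12 g * v.2) * w.1).
    by ring.
  by rewrite v1 w1; ring.
- transitivity ((e21 g * v.1 + e22 g * v.2) * w.2 - (e21 g * w.1 + e22 g * w.2) * v.2).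
    by ring.
  by rewrite v2 w2; ring.
- transitivity ((e21 g * w.1 + e22 g * w.2) * v.1 - (e21 g * v.1 + e22 g * v.2) * w.1).
    by ring.
  by rewrite v2 w2; ring.
Qed.

Lemma cross0_scale v w : w != 0 -> cross v w = 0 ->
  exists s, v = (s * w.1, s * w.2).
Proof.
case: v w => v1 v2 [w1 w2]; rewrite /cross /= => w_neq0 /eqP; rewrite subr_eq0 => /eqP vw.
have [w10 | w10] := eqVneq w1 0.
  have w20 : w2 != 0 by apply: contraNneq w_neq0 => w20; rewrite w10 w20.
  exists (v2 / w2); rewrite divfK // w10 mulr0; congr (_, _).
  by apply: (mulIf w20); rewrite mul0r vw w10 mulr0.
exists (v1 / w1); rewrite divfK //; congr (_, _).
by apply: (mulIf w10); rewrite mulrAC divfK.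
Qed.

Lemma lincomb_cross v w a b c d : cross v w != 0 ->
    (a * v.1 + b * w.1, a * v.2 + b * w.2) = (c * v.1 + d * w.1, c * v.2 + d * w.2) ->
  a = c /\ b = d.
Proof.
move=> vw0 [E1 E2]; split; apply: (mulIf vw0); rewrite /cross.
  transitivity ((a * v.1 + b * w.1) * w.2 - (a * v.2 + b * w.2) * w.1); first by ring.
  by rewrite E1 E2; ring.
transitivity ((a * v.2 + b * w.2) * v.1 - (a * v.1 + b * w.1) * v.2); first by ring.
by rewrite E1 E2; ring.
Qed.

(** As [g] preserves [cross] and fixes [w], the difference of [act g v] and [v] is parallel to [w].
    The coefficient 1 is written out to match [lincomb_cross]. *)
Lemma unipotent_shift g v w : g \in mG S -> cross v w != 0 -> act g w = w ->
  exists s, act g v = (1 * v.1 + s * w.1, 1 * v.2 + s * w.2).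
Proof.
move=> Gg vw0 gw; have w0 : w != 0.
  by apply: contraNneq vw0 => ->; rewrite /cross /= !mulr0 subr0.
have := cross_act v w Gg; rewrite gw => E.
have [|s [E1 E2]] := @cross0_scale ((act g v).1 - v.1, (act g v).2 - v.2) w w0.
  by move/eqP: E; rewrite -subr_eq0 => /eqP E; rewrite -[RHS]E /cross /=; ring.
by exists s; rewrite -E1 -E2 !mul1r /act /=; congr (_, _); ring.
Qed.

(** Compare images of [v]: the left side gives [(1 + s * r) v + s w], the right side [v + s' w].
    Hence [s * r = 0], and [s != 0] because [y1 != 1], so [u1 = 1]; then [u2 = y1^-1 * y2] fixes
    both [v] and [w]. *)
Lemma unipotent_triple_inj v w u1 u2 y1 y2 : cross v w != 0 ->
    u1 \in mG S -> u2 \in mG S -> y1 \in mG S -> y2 \in mG S ->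
    act u1 v = v -> act u2 v = v -> act y1 w = w -> act y2 w = w -> y1 != 1%g ->
  (u1 * y1 * u2 = y2)%g -> (u1 = 1 /\ u2 = 1)%g.
Proof.
move=> vw0 Gu1 Gu2 Gy1 Gy2 u1v u2v y1w y2w y1_neq1 E.
have [s sP] := unipotent_shift Gy1 vw0 y1w.
have [s' sP'] := unipotent_shift Gy2 vw0 y2w.
have wv0 : cross w v != 0 by rewrite -oppr_eq0; move: vw0; congr (_ != 0); rewrite /cross; ring.
have [r rP] := unipotent_shift Gu1 wv0 u1v.
have s0 : s != 0.
  apply: contraNneq y1_neq1 => s0; apply/eqP/(act_inj2 vw0); last by rewrite act1.
  by rewrite sP s0 !mul0r !addr0 !mul1r act1; case: (v).
have := sP'; rewrite -E !actM u2v sP.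
have -> a b : act u1 (a * v.1 + b * w.1, a * v.2 + b * w.2) =
    (a * (act u1 v).1 + b * (act u1 w).1, a * (act u1 v).2 + b * (act u1 w).2).
  by rewrite /act /=; congr (_, _); ring.
rewrite u1v rP /= => E2.
have [|sr _] := @lincomb_cross v w (1 + s * r) s 1 s' vw0.
  by rewrite -E2; congr (_, _); ring.
have r0 : r = 0.
  by apply: (mulfI s0); rewrite mulr0; apply: (addrI 1); rewrite addr0.
have u1E : u1 = 1%g.
  apply: (act_inj2 vw0); rewrite ?act1 //.
  by rewrite rP r0 !mul0r !addr0 !mul1r; case: (w).
split=> //; move: E; rewrite u1E mul1g => E.
apply: (act_inj2 vw0); rewrite ?act1 // (_ : u2 = y1^-1 * y2)%g; last by rewrite -E mulKg.
by rewrite actM y2w -{1}y1w -actM mulVg act1.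
Qed.

(** If all of [B] preserved the line of [v], so would all of SL2; an elementary unipotent and the
    Weyl element, tested at the end, have no common eigenline. *)
Lemma exists_act_cross (B : {set S}) v : <<B>>%g = mG S -> v != 0 ->
  exists2 b, b \in B & cross v (act b v) != 0.
Proof.
move=> genB v0; apply/exists_inP; apply: contraR v0 => /exists_inPn H.
have fixG g : g \in mG S -> cross v (act g v) = 0.
  rewrite -genB; move: g; apply: gen_sym_ind => [|b x Bb].
    by rewrite act1 /cross mulrC subrr.
  have [v0 | v0] := eqVneq v 0; first by rewrite /cross v0 /= !mul0r subr0.
  have cN (p q : F * F) : cross p q = - cross q p by rewrite /cross; ring.
  rewrite cN => /eqP; rewrite oppr_eq0 => /eqP /(cross0_scale v0)[s xv].
  rewrite actM xv; have /eqP := negbNE (H b Bb).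
  move=> E; transitivity (s * cross v (act b v)); last by rewrite E mulr0.
  by rewrite /cross /=; ring.
have d1 : 1 * 1 - 1 * 0 = 1 :> F by ring.
have d2 : 0 * 0 - 1 * (-1) = 1 :> F by ring.
have /= := fixG _ (sl2_in S d1); have /= := fixG _ (sl2_in S d2).
rewrite /cross /= !ent_sl2 //; case: (v) => a b /=.
rewrite !(mul0r, mul1r, add0r, addr0) => E2 E1.
have b0 : b = 0.
  by apply/eqP; rewrite -[_ == 0](expf_eq0 b 2); apply/eqP; rewrite -[RHS]oppr0 -E1; ring.
have a0 : a = 0.
  by apply/eqP; rewrite -[_ == 0](expf_eq0 a 2); apply/eqP; rewrite -[RHS]oppr0 -E2 b0; ring.
by rewrite a0 b0.
Qed.

End Vectors.

Lemma row_dependent (K : fieldType) m n (A : 'M[K]_(m, n)) : (\rank A < m)%N ->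
  exists2 r : 'rV_m, r != 0 & r *m A = 0.
Proof.
move=> rk; have : kermx A != 0 by rewrite kermx_eq0 /row_free neq_ltn rk.
by case/rowV0Pn => r /sub_kermxP rA r0; exists r.
Qed.

(** * Lines of matrices contained in the quadric of determinant 1 *)

Section Collinear.
Variables (F : finFieldType) (S : sl2_model F).
Implicit Types (g h x y w : S) (a b c d t s p : F) (v : F * F).

Definition eigen v g := cross v (act g v) == 0.

(* The trace of the product of the traceless matrix (p1, p2; p3, -p1) with g. *)
Definition trp p1 p2 p3 g : F := p1 * e11 g + p2 * e21 g + p3 * e12 g - p1 * e22 g.

(** The traceless matrix P = (p1, p2; p3, -p1) has determinant 0, so it is nilpotent of rank one
    with image equal to its kernel. A nonzero column [v] of P spans that line, and tr(P g) = 0 says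
    that g maps [v] into the kernel. *)
Lemma nilpotent_eigen p1 p2 p3 : (p1, p2, p3) != (0, 0, 0) -> p1 ^+ 2 + p2 * p3 = 0 ->
  exists2 v, v != 0 & forall g, trp p1 p2 p3 g = 0 -> eigen v g.
Proof.
move=> p_neq0 /eqP; rewrite addr_eq0 => /eqP p11.
have [[p10 p30]|v0] := eqVneq (p1, p3) (0, 0); last first.
  exists (p1, p3) => // g g0; apply/eqP.
  transitivity (- p3 * trp p1 p2 p3 g); last by rewrite g0 mulr0.
  transitivity (e21 g * p1 ^+ 2 + (e22 g - e11 g) * (p1 * p3) - e12 g * p3 ^+ 2).
    by rewrite /cross /=; ring.
  by rewrite p11 /trp; ring.
exists (p2, - p1) => [|g g0].
  by apply: contraNneq p_neq0 => -[-> _]; rewrite p10 p30.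
apply/eqP; transitivity (p2 * trp p1 p2 p3 g); last by rewrite g0 mulr0.
transitivity (e21 g * p2 ^+ 2 + (e11 g - e22 g) * (p1 * p2) - e12 g * p1 ^+ 2).
  by rewrite /cross /=; ring.
by rewrite p11 /trp; ring.
Qed.

Definition on_line x p1 p2 p3 s y :=
  [/\ e11 y = e11 x + s * p1, e12 y = e12 x + s * p2,
      e21 y = e21 x + s * p3 & e22 y = e22 x - s * p1].

(** Along the line, det(x + s P) = 1 - s m - s^2 n with n = - det P and m = tr(P x). Three distinct
    roots 0, 1, s force n = m = 0: P is nilpotent, and tr(P g) vanishes at every point g of the
    line. *)
Lemma collinear_eigen x y z p1 p2 p3 s :
    x \in mG S -> y \in mG S -> z \in mG S ->
    on_line x p1 p2 p3 1 y -> on_line x p1 p2 p3 s z ->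
    x != y -> x != z -> y != z ->
  exists2 v, v != 0 & (eigen v x /\ eigen v y) /\ (eigen v z /\
     forall g, trp p1 p2 p3 g = 0 -> eigen v g).
Proof.
move=> /SL2P dx /SL2P dy /SL2P dz [y1 y2 y3 y4] [z1 z2 z3 z4] xy xz yz.
have p0 : (p1, p2, p3) != (0, 0, 0).
  apply: contraNneq xy => -[p10 p20 p30].
  by apply/eqP/GL2_eqP; rewrite ?(y1, y2, y3, y4) ?(p10, p20, p30) mulr0 ?subr0 ?addr0.
have s0 : s != 0.
  apply: contraNneq xz => s0.
  by apply/eqP/GL2_eqP; rewrite ?(z1, z2, z3, z4) s0 mul0r ?subr0 ?addr0.
have s1 : s - 1 != 0.
  rewrite subr_eq0; apply: contraNneq yz => s1.
  by apply/eqP/GL2_eqP; rewrite ?(z1, z2, z3, z4) ?(y1, y2, y3, y4) s1.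
pose n := p1 ^+ 2 + p2 * p3; pose m := trp p1 p2 p3 x.
have E1 : n + m = 0.
  apply: oppr_inj; rewrite oppr0 -(subrr 1) -{1}dy -dx y1 y2 y3 y4 /n /m /trp; ring.
have E2 : s * (s * n + m) = 0.
  apply: oppr_inj; rewrite oppr0 -(subrr 1) -{1}dz -dx z1 z2 z3 z4 /n /m /trp; ring.
have n0 : n = 0.
  apply: (mulfI s1); apply: (mulfI s0); rewrite !mulr0.
  transitivity (s * (s * n + m) - s * (n + m)); first by ring.
  by rewrite E1 E2 mulr0 subr0.
have m0 : m = 0 by rewrite -E1 n0 add0r.
have [v v0 vP] := nilpotent_eigen p0 n0.
exists v => //; have line0 r g : on_line x p1 p2 p3 r g -> eigen v g.
  case=> g1 g2 g3 g4; apply: vP; rewrite -[RHS]m0 /trp g1 g2 g3 g4.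
  transitivity (m + (r *+ 2) * n); first by rewrite /m /n /trp; ring.
  by rewrite n0 mulr0 addr0.
split; last by split=> //; apply: line0; split; eassumption.
by split; [exact: vP | apply: line0; split; eassumption].
Qed.

Lemma eigenV v g : g \in mG S -> eigen v g^-1%g = eigen v g.
Proof.
move=> Gg; rewrite /eigen -(cross_act v _ Gg) -actM mulgV act1 -oppr_eq0.
by congr (_ == 0); rewrite /cross; ring.
Qed.

Lemma eigen_mulK v g h : g \in mG S -> v != 0 -> eigen v g -> eigen v (g * h)%g ->
  eigen v h.
Proof.
move=> Gg v0 eg; rewrite /eigen actM.
have /eqP := eg; rewrite /eigen => E.
have [|l lP] := cross0_scale v0 (v := act g v).
  by apply: oppr_inj; rewrite oppr0 -[RHS]E /cross; ring.
have El (w : F * F) : cross (act g v) w = l * cross v w by rewrite lP /cross /=; ring.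
have l0 : l != 0.
  apply: contraNneq v0 => l0; rewrite -(act1 S v) -(mulVg g) actM lP l0 !mul0r.
  by rewrite /act /= !mulr0 addr0.
move=> /eqP E2; rewrite -(cross_act v _ Gg); apply/eqP; rewrite El E2 mulr0 //.
Qed.

End Collinear.

(** * Linear algebra of the fibres of the map to (x y, x z) *)

Section ThreePoints.

Definition dep2 (K : fieldType) n (u v : 'rV[K]_n) :=
  exists r s : K, (r, s) != (0, 0) /\ r *: u + s *: v = 0.

Lemma rank_dep2 (K : fieldType) n (u v : 'rV[K]_n) :
  (\rank (col_mx u v) < 2)%N -> dep2 u v.
Proof.
move=> /row_dependent[r r0]; rewrite -[r]hsubmxK mul_row_col => E.
exists (lsubmx r 0 0), (rsubmx r 0 0); split; last by rewrite -!mul_scalar_mx -!mx11_scalar.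
apply: contraNneq r0 => -[r1 r2]; rewrite -[r]hsubmxK.
by rewrite (mx11_scalar (lsubmx r)) (mx11_scalar (rsubmx r)) r1 r2 raddf0 row_mx0.
Qed.

(** If [n1] and [n2] are independent, so are [m], [n1], [n2], since only [m] is nonzero at [w].
    Three independent forms in dimension 4 leave at most a line for [u1] and [u2]. *)
Lemma dep2_of_orthogonal (K : fieldType) (m n1 n2 w u1 u2 : 'rV[K]_4) :
    m *m w^T != 0 -> n1 *m w^T = 0 -> n2 *m w^T = 0 ->
    m *m u1^T = 0 -> m *m u2^T = 0 -> n1 *m u1^T = 0 -> n1 *m u2^T = 0 ->
    n2 *m u1^T = 0 -> n2 *m u2^T = 0 ->
  dep2 n1 n2 \/ dep2 u1 u2.
Proof.
move=> mw0 n1w n2w mu1 mu2 n1u1 n1u2 n2u1 n2u2.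
pose N := col_mx m (col_mx n1 n2); pose U := col_mx u1 u2.
have NU : N *m U^T = 0.
  rewrite tr_col_mx mul_mx_row !mul_col_mx mu1 mu2 n1u1 n1u2 n2u1 n2u2.
  by rewrite !col_mx0 row_mx0.
have := mulmx0_rank_max NU; rewrite mxrank_tr => rk.
have [rkU|rkU] := ltnP (\rank U) 2; first by right; apply: rank_dep2.
left; have [r r0] : exists2 r : 'rV_(1 + (1 + 1)), r != 0 & r *m N = 0.
  by apply: row_dependent; lia.
rewrite -[r]hsubmxK mul_row_col -[rsubmx r]hsubmxK mul_row_col => E.
have r00 : lsubmx r = 0.
  have /(congr1 (mulmx^~ w^T)) := E; rewrite mul0mx !mulmxDl -!mulmxA n1w n2w !mulmx0 !addr0.
  rewrite (mx11_scalar (lsubmx r)) mul_scalar_mx => /eqP; rewrite scaler_eq0 (negPf mw0) orbF.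
  by move/eqP->; rewrite raddf0.
exists (lsubmx (rsubmx r) 0 0), (rsubmx (rsubmx r) 0 0); split; last first.
  by rewrite r00 mul0mx add0r in E; rewrite -!mul_scalar_mx -!mx11_scalar.
apply: contraNneq r0 => -[r1 r2]; rewrite -[r]hsubmxK r00 -[rsubmx r]hsubmxK.
rewrite (mx11_scalar (lsubmx (rsubmx r))) (mx11_scalar (rsubmx (rsubmx r))) r1 r2 raddf0.
by rewrite !row_mx0.
Qed.

Variables (F : finFieldType) (S : sl2_model F).
Implicit Types (g h x y w : S) (t s p : F) (v : F * F).

Definition row4 (a b c d : F) : 'rV[F]_4 := \row_(j < 4) nth 0 [:: a; b; c; d] j.

Lemma row4_dot (a b c d a' b' c' d' : F) :
  row4 a b c d *m (row4 a' b' c' d')^T = (a * a' + b * b' + c * c' + d * d')%:M.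
Proof.
apply/matrixP => i j; rewrite !ord1 !mxE !big_ord_recl big_ord0 !mxE /= addr0 mulr1n.
by rewrite !addrA.
Qed.

Lemma row4_dot0 (a b c d a' b' c' d' : F) :
  a * a' + b * b' + c * c' + d * d' = 0 -> row4 a b c d *m (row4 a' b' c' d')^T = 0.
Proof. by rewrite row4_dot => ->; rewrite raddf0. Qed.

Lemma row4_dep2 (a b c d a' b' c' d' : F) : dep2 (row4 a b c d) (row4 a' b' c' d') ->
  exists r s : F, (r, s) != (0, 0) /\
    [/\ r * a + s * a' = 0, r * b + s * b' = 0, r * c + s * c' = 0 & r * d + s * d' = 0].
Proof.
case=> r [s [rs0 /rowP E]]; exists r, s; split=> //.
by move: (E 0) (E 1) (E 2) (E 3); rewrite !mxE /=.
Qed.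

Lemma trVM x y : x \in mG S ->
  tr (x^-1 * y)%g = e22 x * e11 y - e12 x * e21 y - e21 x * e12 y + e11 x * e22 y.
Proof. by move=> Gx; rewrite /tr !entM !entV //; ring. Qed.

Lemma eigen_of_dependent_inverse t y y2 y3 r s :
    y \in mG S -> y2 \in mG S -> y3 \in mG S -> tr y = t -> tr y2 = t -> tr y3 = t ->
    (r, s) != (0, 0) ->
    r * (e11 y - e11 y2) + s * (e11 y - e11 y3) = 0 ->
    r * (e12 y - e12 y2) + s * (e12 y - e12 y3) = 0 ->
    r * (e21 y - e21 y2) + s * (e21 y - e21 y3) = 0 ->
    r * (e22 y - e22 y2) + s * (e22 y - e22 y3) = 0 ->
  [\/ y2 = y3, y = y2, y = y3 |
      exists v, [/\ v != 0, eigen v y, eigen v y2 & eigen v y3]].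
Proof.
move=> Gy G2 G3 ty ty2 ty3 rs0 F1 F2 F3 F4.
have [->|y2y3] := eqVneq y2 y3; first by constructor 1.
have [Ey2|yy2] := eqVneq y y2; first by constructor 2.
have [Ey3|yy3] := eqVneq y y3; first by constructor 3.
have s0 : s != 0.
  apply: contraNneq yy2 => s0; have r0 : r != 0.
    by apply: contraNneq rs0 => ->; rewrite s0.
  by apply/eqP/GL2_eqP; apply/eqP; rewrite -subr_eq0; apply/eqP; apply: (mulfI r0);
    rewrite mulr0; [rewrite -[RHS]F1|rewrite -[RHS]F2|rewrite -[RHS]F3|rewrite -[RHS]F4];
    rewrite s0 mul0r addr0.
have scaleE (a b : F) : r * (a - b) = - (r * (b - a)) by ring.
have sE (a b c : F) : r * (a - b) + s * (a - c) = 0 -> c = a + - r / s * (b - a).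
  move=> E; apply: (mulfI s0).
  by rewrite -[RHS]subr0 -[in RHS]E; field.
have L1 : on_line y (e11 y2 - e11 y) (e12 y2 - e12 y) (e21 y2 - e21 y) 1 y2.
  split; try ring.
  by apply: (addrI (e11 y2)); rewrite -/(tr y2) ty2 -ty /tr; ring.
have L2 : on_line y (e11 y2 - e11 y) (e12 y2 - e12 y) (e21 y2 - e21 y) (- r / s) y3.
  split; try exact: sE.
  by apply: (addrI (e11 y3)); rewrite -/(tr y3) ty3 (sE _ _ _ F1) -ty /tr; ring.
have [v v0 [[vw v2] [v3 _]]] := collinear_eigen Gy G2 G3 L1 L2 yy2 yy3 y2y3.
by constructor 4; exists v.
Qed.

Lemma mul_det_eq0 (d1 d2 a b c d : F) : a * d - b * c = 1 ->
  d1 * a + d2 * c = 0 -> d1 * b + d2 * d = 0 -> d1 = 0 /\ d2 = 0.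
Proof.
move=> det1 E1 E2; split.
  transitivity ((d1 * a + d2 * c) * d - (d1 * b + d2 * d) * c).
    by rewrite -[LHS]mulr1 -det1; ring.
  by rewrite E1 E2 !mul0r subr0.
transitivity ((d1 * b + d2 * d) * a - (d1 * a + d2 * c) * b).
  by rewrite -[LHS]mulr1 -det1; ring.
by rewrite E1 E2 !mul0r subr0.
Qed.

Lemma collinear_of_dependent t y y' y'' r s :
    y \in mG S -> y' \in mG S -> y'' \in mG S -> tr y = t -> tr y' = t -> tr y'' = t ->
    (r, s) != (0, 0) -> y != y' -> y != y'' -> y' != y'' ->
    let d (f : S -> F) := r * (f y' - f y) + s * (f y'' - f y) in
    d e11 = 0 -> d e12 = 0 -> d e21 = 0 ->
  exists2 v, v != 0 & eigen v y /\ (forall g,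
    trp (e11 y' - e11 y) (e12 y' - e12 y) (e21 y' - e21 y) g = 0 -> eigen v g).
Proof.
move=> Gy Gy' Gy'' ty ty' ty'' rs0 yy' yy'' y'y'' d D1 D2 D3.
have e22E x : tr x = t -> e22 x = e22 y - (e11 x - e11 y).
  by move=> tx; apply: (addrI (e11 x)); rewrite -/(tr x) tx -ty /tr; ring.
have s0 : s != 0.
  apply: contraNneq yy' => s0; have r0 : r != 0.
    by apply: contraNneq rs0 => ->; rewrite s0.
  have dE f : d f = 0 -> f y = f y'.
    rewrite /d s0 mul0r addr0 => /eqP; rewrite mulf_eq0 (negPf r0) /= subr_eq0.
    by move=> /eqP.
  apply/eqP/GL2_eqP; try exact: dE.
  by rewrite (e22E y' ty') (dE _ D1) subrr subr0.
have L1 : on_line y (e11 y' - e11 y) (e12 y' - e12 y) (e21 y' - e21 y) 1 y'.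
  by split; rewrite ?(e22E y' ty'); ring.
have sE f : d f = 0 -> f y'' = f y + - r / s * (f y' - f y).
  by move=> E; apply: (mulfI s0); rewrite -[RHS]addr0 -[in RHS]E /d; field.
have L2 : on_line y (e11 y' - e11 y) (e12 y' - e12 y) (e21 y' - e21 y) (- r / s) y''.
  by split; try exact: sE; rewrite (e22E y'' ty'') (sE _ D1); ring.
have [v v0 [[vy _] [_ vP]]] := collinear_eigen Gy Gy' Gy'' L1 L2 yy' yy'' y'y''.
by exists v.
Qed.

(** By Cayley-Hamilton the inverse is tr(x) - x in SL2, so elements of equal trace satisfy x^-1 -
    y^-1 = -(x - y). Here both x^-1 y z and y^-1 y z have trace t. *)
Lemma trp_diff t x y z : x \in mG S -> y \in mG S -> tr x = t -> tr y = t -> tr z = t ->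
  tr (x^-1 * (y * z))%g = t ->
  trp (e11 x - e11 y) (e12 x - e12 y) (e21 x - e21 y) (y * z)%g = 0.
Proof.
move=> Gx Gy tx ty tz E; apply: oppr_inj; rewrite oppr0.
transitivity (tr (x^-1 * (y * z))%g - tr (y^-1 * (y * z))%g); last first.
  by rewrite E mulKg tz subrr.
rewrite !trVM //; move: (y * z)%g => q.
have -> : e22 x = e22 y - (e11 x - e11 y).
  by apply: (addrI (e11 x)); rewrite -/(tr x) tx -ty /tr; ring.
by rewrite /trp; ring.
Qed.

(* The coefficients of the linear form u |-> tr (d * y * u), where d = (d1, d2; d3, - d1). *)
Definition trp_row d1 d2 d3 y : 'rV[F]_4 :=
  row4 (d1 * e11 y + d2 * e21 y) (d3 * e11 y - d1 * e21 y)
       (d1 * e12 y + d2 * e22 y) (d3 * e12 y - d1 * e22 y).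

Definition diff_row x y := row4 (e11 x - e11 y) (e12 x - e12 y) (e21 x - e21 y) (e22 x - e22 y).

Lemma trp_rowE d1 d2 d3 y z :
  trp_row d1 d2 d3 y *m (row4 (e11 z) (e12 z) (e21 z) (e22 z))^T = (trp d1 d2 d3 (y * z)%g)%:M.
Proof. by rewrite row4_dot; congr (_%:M); rewrite /trp !entM; ring. Qed.

Lemma trp_row_diff d1 d2 d3 y z z' :
    trp d1 d2 d3 (y * z)%g = 0 -> trp d1 d2 d3 (y * z')%g = 0 ->
  trp_row d1 d2 d3 y *m (diff_row z z')^T = 0.
Proof.
move=> z0 z'0; apply: row4_dot0.
transitivity (trp d1 d2 d3 (y * z)%g - trp d1 d2 d3 (y * z')%g).
  by rewrite /trp !entM; ring.
by rewrite z0 z'0 subrr.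
Qed.

Lemma tr_row_diff t z z' : tr z = t -> tr z' = t -> row4 1 0 0 1 *m (diff_row z z')^T = 0.
Proof.
move=> tz tz'; apply: row4_dot0; transitivity (tr z - tr z'); last by rewrite tz tz' subrr.
by rewrite /tr; ring.
Qed.

(** [y], [y'], [y''] are the first coordinates of three points of a fibre, the first point being
    [(y, y2, y3)]. The forms tr(u), tr((y' - y) y u) and tr((y'' - y) y u) kill [y^-1 - y2] and
    [y^-1 - y3]; at [y^-1] the first takes the value t and the others 0. So either [y], [y'], [y'']
    or [y^-1], [y2], [y3] are collinear, and [collinear_eigen] applies unless points coincide. *)
Lemma three_points t y y' y'' y2 y3 :
    y \in mG S -> y' \in mG S -> y'' \in mG S -> y2 \in mG S -> y3 \in mG S ->
    t != 0 -> tr y = t -> tr y' = t -> tr y'' = t -> tr y2 = t -> tr y3 = t ->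
    tr (y'^-1 * (y * y2))%g = t -> tr (y'^-1 * (y * y3))%g = t ->
    tr (y''^-1 * (y * y2))%g = t -> tr (y''^-1 * (y * y3))%g = t ->
    y != y' -> y != y'' -> y' != y'' ->
  [\/ y2 = y3, y^-1%g = y2, y^-1%g = y3 |
      exists v, [/\ v != 0, eigen v y, eigen v y2 & eigen v y3]].
Proof.
move=> Gy Gy' Gy'' G2 G3 t0 ty ty' ty'' ty2 ty3 t12 t13 t22 t23 yy' yy'' y'y''.
have Gw : (y^-1)%g \in mG S by rewrite groupV.
have tw : tr (y^-1)%g = t by rewrite -ty /tr !entV // addrC.
have E12 := trp_diff Gy' Gy ty' ty ty2 t12; have E13 := trp_diff Gy' Gy ty' ty ty3 t13.
have E22 := trp_diff Gy'' Gy ty'' ty ty2 t22; have E23 := trp_diff Gy'' Gy ty'' ty ty3 t23.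
have trpw d1 d2 d3 : trp d1 d2 d3 (y * y^-1)%g = 0 by rewrite mulgV /trp !ent1; ring.
pose P x := trp_row (e11 x - e11 y) (e12 x - e12 y) (e21 x - e21 y) y.
have Hdep : dep2 (P y') (P y'') \/ dep2 (diff_row y^-1%g y2) (diff_row y^-1%g y3).
  apply: (@dep2_of_orthogonal F (row4 1 0 0 1) _ _
           (row4 (e11 y^-1%g) (e12 y^-1%g) (e21 y^-1%g) (e22 y^-1%g))).
  - rewrite row4_dot; apply: contraNneq t0 => /matrixP/(_ 0 0); rewrite !mxE /= => E.
    by apply/eqP; rewrite -[RHS]E -tw /tr; ring.
  - by rewrite trp_rowE trpw raddf0.
  - by rewrite trp_rowE trpw raddf0.
  - exact: tr_row_diff tw ty2.
  - exact: tr_row_diff tw ty3.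
  - exact: trp_row_diff.
  - exact: trp_row_diff.
  - exact: trp_row_diff.
  - exact: trp_row_diff.
case: Hdep => /row4_dep2[r [s [rs0 [F1 F2 F3 F4]]]]; last first.
  have [] := eigen_of_dependent_inverse Gw G2 G3 tw ty2 ty3 rs0 F1 F2 F3 F4.
  - by constructor 1.
  - by constructor 2.
  - by constructor 3.
  - by case=> v [v0 ey e2 e3]; constructor 4; exists v; split=> //; rewrite -eigenV.
(* Now the two forms are dependent; cancelling the invertible factor [y] gives the same relation
   between [y' - y] and [y'' - y]. *)
have /SL2P dy := Gy; pose d (f : S -> F) := r * (f y' - f y) + s * (f y'' - f y).
have [D1 D2] : d e11 = 0 /\ d e12 = 0.
  by apply: (mul_det_eq0 dy); [rewrite -[RHS]F1 | rewrite -[RHS]F3];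
    rewrite /d; ring.
have [_ D3] : - d e11 = 0 /\ d e21 = 0.
  apply: (@mul_det_eq0 _ _ (e22 y) (e21 y) (e12 y) (e11 y)); first by rewrite -dy; ring.
    by rewrite -[RHS]F4 /d; ring.
  by rewrite -[RHS]F2 /d; ring.
have [v v0 [vy vP]] := collinear_of_dependent Gy Gy' Gy'' ty ty' ty'' rs0 yy' yy'' y'y'' D1 D2 D3.
constructor 4; exists v.
by split=> //; [move: (vP _ E12) | move: (vP _ E13)]; apply: eigen_mulK.
Qed.

End ThreePoints.

Lemma leq_card_fibres (T1 T2 : finType) (X : {set T1}) (Y : {set T2}) (f : T1 -> T2) k :
    (forall x, x \in X -> f x \in Y) ->
    (forall y, y \in Y -> #|[set x in X | f x == y]| <= k)%N ->
  (#|X| <= k * #|Y|)%N.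
Proof.
move=> fXY fib; rewrite -sum1_card (partition_big f (mem Y)) //= mulnC -sum_nat_const.
apply: leq_sum => y Yy; apply: leq_trans (fib y Yy).
by rewrite -sum1_card; apply/eq_leq/eq_bigl => x; rewrite inE.
Qed.

(** * Elements of bounded powers with a fixed vector or eigenline *)

Section Counting.
Variables (F : finFieldType) (S : sl2_model F) (B : {set S}).
Hypotheses (B1 : 1%g \in B) (BV : (B^-1 = B)%g) (genB : <<B>>%g = mG S).
Implicit Types (g h x y : S) (t : F) (v w : F * F) (k i j : nat).

Lemma expgB_sub k x : x \in (B ^+ k)%g -> x \in mG S.
Proof.
rewrite -genB; elim: k x => [|k IHk] x; first by rewrite expg0 => /set1P->; rewrite group1.
by rewrite expgS => /mulsgP[b y Bb /IHk Gy ->]; rewrite groupM // mem_gen.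
Qed.

Lemma expgB_mul i j x y : x \in (B ^+ i)%g -> y \in (B ^+ j)%g -> (x * y)%g \in (B ^+ (i + j))%g.
Proof. by rewrite expgnDr; apply: mem_mulg. Qed.

Lemma expgB1 k : 1%g \in (B ^+ k)%g.
Proof.
elim: k => [|k IHk]; first by rewrite expg0 inE.
by rewrite expgS -[1%g]mulg1 mem_mulg.
Qed.

Lemma expgB_le i j : (i <= j)%N -> (B ^+ i \subset B ^+ j)%g.
Proof.
move=> /subnK <-; apply/subsetP => x Bx; rewrite -[x]mul1g; apply: expgB_mul => //.
exact: expgB1.
Qed.

Lemma expgB_inv k x : x \in (B ^+ k)%g -> (x^-1)%g \in (B ^+ k)%g.
Proof.
elim: k x => [|k IHk] x; first by rewrite expg0 => /set1P->; rewrite invg1 inE.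
rewrite {1}expgSr => /mulsgP[y b /IHk By Bb ->]; rewrite invMg expgS mem_mulg //.
by rewrite -BV memV_invg.
Qed.

Definition fixB v k := [set x in (B ^+ k)%g | act x v == v].

Lemma fixBP v k x : x \in fixB v k -> x \in (B ^+ k)%g /\ act x v = v.
Proof. by rewrite inE => /andP[-> /eqP]. Qed.

(* If b does not preserve the line of v, then (x, y, z) |-> x * (b * y * b^-1) * z is injective
   on the triples of elements fixing v with y != 1. *)
Lemma card_fixB v k : v != 0 ->
  (#|fixB v k| * #|fixB v k| * #|fixB v k|.-1 <= #|(B ^+ (3 * k + 2))%g|)%N.
Proof.
move=> v0; set M := fixB v k; have [b Bb vb] := exists_act_cross genB v0.
have Gb : b \in mG S by apply: (@expgB_sub 1); rewrite expg1.
have M1 : 1%g \in M by rewrite inE expgB1 act1 eqxx.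
pose f (p : S * (S * S)) := (p.1 * (b * p.2.1 * b^-1) * p.2.2)%g.
have -> : #|M|.-1 = #|M :\ 1%g| by rewrite [X in X.-1](cardsD1 1%g M) M1.
rewrite -mulnA [(#|M| * #|M :\ 1%g|)%N]mulnC -!cardsX -(card_in_imset (f := f)).
  apply/subset_leq_card/subsetP => _ /imsetP[[x [y z]] xyz ->].
  case/setXP: xyz => /fixBP[Mx _] /setXP[/= /setD1P[_ /fixBP[My _]] /fixBP[Mz _]].
  rewrite /f /= (_ : 3 * k + 2 = (k + (1 + k + 1)) + k)%N; last by lia.
  by rewrite !expgB_mul ?expg1 // -[b^-1%g]mul1g -BV mul1g memV_invg.
move=> [x1 [y1 z1]] [x2 [y2 z2]]; rewrite /f /=.
case/setXP=> /fixBP[/expgB_sub Gx1 x1v] /setXP[/= /setD1P[y1n /fixBP[/expgB_sub Gy1 y1v]]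
  /fixBP[/expgB_sub Gz1 z1v]].
case/setXP=> /fixBP[/expgB_sub Gx2 x2v] /setXP[/= /setD1P[y2n /fixBP[/expgB_sub Gy2 y2v]]
  /fixBP[/expgB_sub Gz2 z2v]] E.
have fixV x : act x v = v -> act x^-1%g v = v.
  by move=> xv; rewrite -{1}xv -actM mulVg act1.
have conjw y : act y v = v -> act (b * y * b^-1)%g (act b v) = act b v.
  by move=> yv; rewrite -actM mulgKV actM yv.
have E2 : ((x2^-1 * x1) * (b * y1 * b^-1) * (z1 * z2^-1) = b * y2 * b^-1)%g.
  by apply: (mulgI x2); apply: (mulIg z2); rewrite -E !mulgA mulgV mul1g mulgKV.
have [] := unipotent_triple_inj vb _ _ _ _ _ _ _ _ _ E2.
- by rewrite groupM ?groupV.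
- by rewrite groupM ?groupV.
- by rewrite !groupM ?groupV.
- by rewrite !groupM ?groupV.
- by rewrite actM x1v fixV.
- by rewrite actM fixV.
- exact: conjw.
- exact: conjw.
- apply: contraNneq y1n => E1; apply/eqP; apply: (mulgI b); apply: (mulIg b^-1%g).
  by rewrite E1 mulg1 mulgV.
move/eqP; rewrite -eq_mulVg1 => /eqP ex; move/eqP; rewrite -eq_mulgV1 => /eqP ez.
by move: E; rewrite ex ez => /mulIg/mulgI/mulIg/mulgI ->.
Qed.

Definition trace_set t k := [set x in (B ^+ k)%g | tr x == t].

Lemma trace_setP t k x : x \in trace_set t k -> [/\ x \in (B ^+ k)%g, x \in mG S & tr x = t].
Proof. by rewrite inE => /andP[Bx /eqP]; split=> //; apply: expgB_sub Bx. Qed.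

(** The eigenvalue on [v] is a root of l^2 - t l + 1, so it is [l0] or [t - l0]. Two elements with
    the same eigenvalue differ by an element of [B ^+ (k + k)] fixing [v]. *)
Lemma card_eigen_trace_set v t k : v != 0 ->
  (#|[set x in trace_set t k | eigen v x]| <= 2 * #|fixB v (k + k)|)%N.
Proof.
move=> v0; set E := [set x in _ | _].
have eigP x : x \in E -> [/\ x \in (B ^+ k)%g, x \in mG S &
    exists l, act x v = (l * v.1, l * v.2) /\ l ^+ 2 - t * l + 1 = 0].
  rewrite inE => /andP[/trace_setP[Bx Gx tx] /eqP ex]; split=> //.
  have [|l lP] := cross0_scale v0 (v := act x v).
    by apply: oppr_inj; rewrite oppr0 -[RHS]ex /cross; ring.
  exists l; split=> //; have /SL2P dx := Gx.
  case: v lP v0 {E ex} => v1 v2; rewrite /act /= => -[E1 E2] v0.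
  have L1 : (l ^+ 2 - t * l + 1) * v1 = 0.
    rewrite -tx -dx /tr.
    transitivity ((l - e22 x) * (l * v1 - (e11 x * v1 + e12 x * v2))
      + e12 x * (l * v2 - (e21 x * v1 + e22 x * v2))); first by ring.
    by rewrite E1 E2 !subrr !mulr0 addr0.
  have L2 : (l ^+ 2 - t * l + 1) * v2 = 0.
    rewrite -tx -dx /tr.
    transitivity ((l - e11 x) * (l * v2 - (e21 x * v1 + e22 x * v2))
      + e21 x * (l * v1 - (e11 x * v1 + e12 x * v2))); first by ring.
    by rewrite E1 E2 !subrr !mulr0 addr0.
  apply/eqP; apply: contraNT v0 => l0.
  by rewrite -[v1](mulKf l0) L1 -[v2](mulKf l0) L2 !mulr0.
pose El l := [set x in E | act x v == (l * v.1, l * v.2)].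
have ElE l x : (x \in El l) = (x \in E) && (act x v == (l * v.1, l * v.2)).
  by rewrite /El [LHS]inE.
have cEl l : (#|El l| <= #|fixB v (k + k)|)%N.
  have [->|[x0 /[!ElE] /andP[Ex0 /eqP x0v]]] := set_0Vmem (El l); first by rewrite cards0.
  rewrite -(card_imset _ (mulgI x0^-1%g)).
  apply/subset_leq_card/subsetP => _ /imsetP[x /[!ElE] /andP[Ex /eqP xv] ->].
  have [Bx0 _ _] := eigP x0 Ex0; have [Bx _ _] := eigP x Ex.
  rewrite inE expgB_mul ?expgB_inv //=; apply/eqP.
  by rewrite actM xv -x0v -actM mulVg act1.
have [->|[x0 Ex0]] := set_0Vmem E; first by rewrite cards0.
have [_ _ [l0 [_ lE]]] := eigP x0 Ex0.
suff sub : E \subset El l0 :|: El (t - l0).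
  apply: leq_trans (subset_leq_card sub) _; apply: leq_trans (leq_card_setU _ _) _.
  by rewrite mul2n -addnn leq_add.
apply/subsetP => x Ex; have [_ _ [l [xv lE']]] := eigP x Ex.
have /eqP : (l - l0) * (l - (t - l0)) = 0.
  transitivity ((l ^+ 2 - t * l + 1) - (l0 ^+ 2 - t * l0 + 1)); first by ring.
  by rewrite lE lE' subrr.
rewrite mulf_eq0 !subr_eq0 => /orP[]/eqP le; rewrite in_setU !ElE Ex xv le eqxx ?orbT //.
Qed.

End Counting.

(** * The Larsen-Pink inequality for conjugacy classes *)

Section ProjectiveLine.
Variables (F : finFieldType) (S : sl2_model F).
Implicit Types (g h x y : S) (t : F) (v w : F * F).

(** Representatives of the projective line, [None] being the point at infinity. *)
Definition pt (o : option F) : F * F := if o is Some s then (s, 1) else (1, 0).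

Lemma pt_neq0 o : pt o != 0.
Proof.
suff : (pt o).1 != 0 \/ (pt o).2 != 0 by case=> H; apply: contraNneq H => ->.
by case: o => [s|]; [right | left]; rewrite oner_neq0.
Qed.

Lemma eigen_pt v : v != 0 -> exists o, forall g, eigen v g -> eigen (pt o) g.
Proof.
case: v => v1 v2 v0; have [v20|v20] := eqVneq v2 0.
  have v10 : v1 != 0 by apply: contraNneq v0 => ->; rewrite v20.
  exists None => g; rewrite /eigen /cross /act v20 /= => /eqP E.
  by apply/eqP/(mulfI v10)/(mulfI v10); rewrite !mulr0 -[RHS]E; ring.
exists (Some (v1 / v2)) => g; rewrite /eigen /cross /act /= => /eqP E.
apply/eqP/(mulfI v20)/(mulfI v20); rewrite !mulr0 -[RHS]E.
by field.
Qed.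

(** The point at infinity counts for 1; the finite eigenlines are roots of a polynomial of degree at
    most 2, which is zero only for scalar [g], excluded by the trace. *)
Lemma card_eigen_pt g : g \in mG S -> tr g ^+ 2 != 4%:R ->
  (#|[set o | eigen (pt o) g]| <= 3)%N.
Proof.
move=> /SL2P dg tg; rewrite (cardsD1 None) -[3%N]/(1 + 2)%N leq_add ?leq_b1 //.
pose p : {poly F} := e21 g *: 'X ^+ 2 + (e22 g - e11 g) *: 'X - (e12 g)%:P.
have pE s : p.[s] = cross (pt (Some s)) (act g (pt (Some s))).
  by rewrite /p !hornerE /cross /=; ring.
have p0 : p != 0.
  apply: contraNneq tg => p0; have coefp i : p`_i = 0 by rewrite p0 coef0.
  have := coefp 0; have := coefp 1; have := coefp 2.
  rewrite /p !coefB !coefD !coefZ !coefXn !coefX !coefC /= !mulr0 !mulr1 !add0r !subr0 addr0.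
  move=> c2 c1 /eqP; rewrite oppr_eq0 => /eqP c0.
  have e : e22 g = e11 g by apply/eqP; rewrite -subr_eq0 c1.
  apply/eqP; transitivity (4%:R * (e11 g * e22 g - e12 g * e21 g)); last by rewrite dg mulr1.
  by rewrite /tr c0 c2 e; ring.
have szp : (size p <= 3)%N.
  rewrite /p; apply: leq_trans (size_polyD _ _) _; rewrite geq_max; apply/andP; split.
    apply: leq_trans (size_polyD _ _) _; rewrite geq_max; apply/andP; split.
      by apply: leq_trans (size_scale_leq _ _) _; rewrite size_polyXn.
    by apply: leq_trans (size_scale_leq _ _) _; rewrite size_polyX.
  by rewrite size_polyN (leq_trans (size_polyC_leq1 _)).
have -> : #|[set o | eigen (pt o) g] :\ None| = size (enum [set s | eigen (pt (Some s)) g]).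
  rewrite -cardE -[RHS](card_imset _ (@Some_inj _)); apply: eq_card => -[s|]; rewrite !inE /=.
    by rewrite mem_imset ?inE //; apply: Some_inj.
  by apply/esym/imsetP => -[].
rewrite -ltnS; apply: leq_trans szp.
apply: max_poly_roots => //; last exact: enum_uniq.
by apply/allP => s; rewrite mem_enum inE => /eqP E; rewrite /root pE E.
Qed.

End ProjectiveLine.

Section LarsenPink.
Variables (F : finFieldType) (S : sl2_model F) (B : {set S}).
Hypotheses (BV : (B^-1 = B)%g) (genB : <<B>>%g = mG S).
Variables (t : F) (k L : nat).
Hypotheses (t0 : t != 0) (t4 : t ^+ 2 != 4%:R).
Hypothesis fixL : forall v, v != 0 -> (#|fixB B v (k + k)| <= L)%N.
Implicit Types (x y : S) (p : S * (S * S)).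

Let V := trace_set B t k.
Let V3 := setX V (setX V V).
(** The sets [X1] to [X4] match the four outcomes of [three_points]. *)
Let X1 := [set p in V3 | p.2.1 == p.2.2].
Let X2 := [set p in V3 | (p.1^-1)%g == p.2.1].
Let X3 := [set p in V3 | (p.1^-1)%g == p.2.2].
Let X4 := [set p in V3 | [exists o, [&& eigen (pt o) p.1, eigen (pt o) p.2.1
                                     & eigen (pt o) p.2.2]]].

Lemma card_X1 : (#|X1| <= #|V| * #|V|)%N.
Proof.
rewrite -cardsX -[leqRHS]mul1n; apply: (leq_card_fibres (f := fun p => (p.1, p.2.1))).
  by move=> [x [y z]]; rewrite !inE /= => /andP[/and3P[-> -> _]].
move=> [x y] _; rewrite leqNgt; apply/negP => /card_gt1P[[x1 [y1 z1]] [[x2 [y2 z2]] []]].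
rewrite !inE /= => /andP[/andP[_ /eqP <-] /eqP[-> ->]] /andP[/andP[_ /eqP <-] /eqP[-> ->]].
by rewrite eqxx.
Qed.

Lemma card_X2 : (#|X2| <= #|V| * #|V|)%N.
Proof.
rewrite -cardsX -[leqRHS]mul1n; apply: (leq_card_fibres (f := fun p => (p.1, p.2.2))).
  by move=> [x [y z]]; rewrite !inE /= => /andP[/and3P[-> _ ->]].
move=> [x y] _; rewrite leqNgt; apply/negP => /card_gt1P[[x1 [y1 z1]] [[x2 [y2 z2]] []]].
rewrite !inE /= => /andP[/andP[_ /eqP <-] /eqP[-> ->]] /andP[/andP[_ /eqP <-] /eqP[-> ->]].
by rewrite eqxx.
Qed.

Lemma card_X3 : (#|X3| <= #|V| * #|V|)%N.
Proof.
rewrite -cardsX -[leqRHS]mul1n; apply: (leq_card_fibres (f := fun p => (p.1, p.2.1))).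
  by move=> [x [y z]]; rewrite !inE /= => /andP[/and3P[-> -> _]].
move=> [x y] _; rewrite leqNgt; apply/negP => /card_gt1P[[x1 [y1 z1]] [[x2 [y2 z2]] []]].
rewrite !inE /= => /andP[/andP[_ /eqP <-] /eqP[-> ->]] /andP[/andP[_ /eqP <-] /eqP[-> ->]].
by rewrite eqxx.
Qed.

(** Choose the first coordinate in [V], then one of its at most 3 eigenlines; each other coordinate
    is one of at most [2 * L] elements with that eigenline. *)
Lemma card_X4 : (#|X4| <= (2 * L) ^ 2 * (3 * #|V|))%N.
Proof.
pose o_of p := odflt None [pick o | [&& eigen (pt o) p.1, eigen (pt o) p.2.1
                                     & eigen (pt o) p.2.2]].
have oP p : p \in X4 ->
    [&& eigen (pt (o_of p)) p.1, eigen (pt (o_of p)) p.2.1 & eigen (pt (o_of p)) p.2.2].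
  rewrite inE => /andP[_ /existsP[o oP]]; rewrite /o_of.
  by case: pickP => // /(_ o); rewrite oP.
have X4V p : p \in X4 -> [/\ p.1 \in V, p.2.1 \in V & p.2.2 \in V].
  by rewrite inE; case: p => x [y z] /andP[/setXP[? /setXP[]]].
pose Y := [set q : S * option F | (q.1 \in V) && eigen (pt q.2) q.1].
have YE q : (q \in Y) = (q.1 \in V) && eigen (pt q.2) q.1 by rewrite [LHS]inE.
have cY : (#|Y| <= 3 * #|V|)%N.
  apply: (leq_card_fibres (f := fun q => q.1)) => [q|y Vy].
    by rewrite YE => /andP[].
  have [_ Gy ty] := trace_setP genB Vy.
  have t4y : tr y ^+ 2 != 4%:R by rewrite ty.
  apply: leq_trans (card_eigen_pt Gy t4y).
  rewrite -(card_in_imset (f := fun q : S * option F => q.2)).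
    apply/subset_leq_card/subsetP => _ /imsetP[[x o] xo ->].
    by case/setIdP: xo; rewrite YE inE /= => /andP[_ eo] /eqP <-.
  by move=> [x1 o1] [x2 o2] /setIdP[_ /eqP/= ->] /setIdP[_ /eqP/= ->] /= ->.
apply: leq_trans (leq_mul (leqnn _) cY).
apply: (leq_card_fibres (f := fun p => (p.1, o_of p))) => [p X4p|[y o] Yyo].
  by rewrite YE /=; have /and3P[-> _ _] := oP p X4p; have [-> _ _] := X4V p X4p.
pose E := [set x in V | eigen (pt o) x].
have cE : (#|E| <= 2 * L)%N.
  apply: leq_trans (card_eigen_trace_set BV genB t k (pt_neq0 o)) _.
  by rewrite leq_mul2l fixL ?pt_neq0 ?orbT.
apply: leq_trans (_ : #|setX E E| <= _)%N; last by rewrite cardsX -mulnn leq_mul.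
rewrite -(card_in_imset (f := fun p => p.2)).
  apply/subset_leq_card/subsetP => _ /imsetP[p /setIdP[X4p /eqP[py po]] ->].
  have /and3P[_ e2 e3] := oP p X4p; have [_ V2 V3'] := X4V p X4p.
  by rewrite po in e2 e3; rewrite [p.2]surjective_pairing; apply/setXP; split; rewrite inE ?V2 ?V3'.
by move=> [x1 p1] [x2 p2] /setIdP[_ /eqP[/= -> _]] /setIdP[_ /eqP[/= -> _]] /= ->.
Qed.

(* The fibres of (x, y, z) |-> (x * y, x * z) on the triples outside X1 to X4 have at most
   two points. *)
Lemma larsen_pink_class :
  (#|V| ^ 3 <= 2 * #|(B ^+ (k + k))%g| ^ 2 + 3 * #|V| ^ 2 + (2 * L) ^ 2 * (3 * #|V|))%N.
Proof.
pose X := X1 :|: X2 :|: X3 :|: X4.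
have cX : (#|X| <= 3 * #|V| ^ 2 + (2 * L) ^ 2 * (3 * #|V|))%N.
  apply: leq_trans (leq_card_setU _ _) (leq_add _ card_X4).
  apply: leq_trans (leq_card_setU _ _) _; rewrite -mulnn mulSn addnC.
  apply: leq_add card_X3 _; rewrite mul2n -addnn.
  exact: leq_trans (leq_card_setU _ _) (leq_add card_X1 card_X2).
have -> : (#|V| ^ 3 = #|V3|)%N by rewrite !cardsX.
rewrite -(cardsID X V3) addnC -addnA leq_add //; last first.
  by apply: leq_trans cX; apply/subset_leq_card/subsetIr.
rewrite -mulnn -cardsX.
have V3P p : p \in V3 :\: X -> [/\ p.1 \in V, p.2.1 \in V, p.2.2 \in V & p \notin X].
  by case: p => x [y z] /setDP[/setXP[? /setXP[]]].
have VB x : x \in V -> x \in (B ^+ k)%g by case/(trace_setP genB).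
apply: (leq_card_fibres (f := fun p => (p.1 * p.2.1, p.1 * p.2.2)%g)) => [p /V3P[V1 V2 V3' _]|].
  by apply/setXP; split; apply: expgB_mul; apply: VB.
move=> [x1 x2] _; rewrite leqNgt; apply/negP => /card_gt2P[p [p' [p'' []]]] [].
move=> /setIdP[/V3P[V1 V2 V3' nXp] /eqP[E1 E2]].
move=> /setIdP[/V3P[V1' V2' V3'' _] /eqP[E1' E2']].
move=> /setIdP[/V3P[V1'' V2'' V3''' _] /eqP[E1'' E2'']].
(* Within a fibre the first coordinate determines the point, so three points have the distinct first
   coordinates that [three_points] requires. *)
have neq q q' : (q.1 * q.2.1 = x1)%g -> (q.1 * q.2.2 = x2)%g -> (q'.1 * q'.2.1 = x1)%g ->
    (q'.1 * q'.2.2 = x2)%g -> q != q' -> q.1 != q'.1.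
  case: q q' => [y [y2 y3]] [y' [y2' y3']] /= <- <- e1 e2; apply: contraNneq => e.
  by move: e1 e2; rewrite -e => /mulgI-> /mulgI->.
move=> [pp' p'p'' p''p].
have [_ G1 t1] := trace_setP genB V1; have [_ G2 t2] := trace_setP genB V2.
have [_ G3 t3] := trace_setP genB V3'; have [_ G1' t1'] := trace_setP genB V1'.
have [_ G1'' t1''] := trace_setP genB V1''.
have tr_left q y z : (q.1 * q.2.1 = y)%g -> (q.1 * q.2.2 = z)%g -> q.2.1 \in V -> q.2.2 \in V ->
    tr (q.1^-1 * y)%g = t /\ tr (q.1^-1 * z)%g = t.
  by move=> <- <-; rewrite !mulKg => /(trace_setP genB)[_ _ ->] /(trace_setP genB)[_ _ ->].
have [T1 T2] := tr_left _ _ _ E1' E2' V2' V3''.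
have [T3 T4] := tr_left _ _ _ E1'' E2'' V2'' V3'''.
have y12 := neq _ _ E1 E2 E1' E2' pp'; have y23 := neq _ _ E1' E2' E1'' E2'' p'p''.
have := neq _ _ E1'' E2'' E1 E2 p''p; rewrite eq_sym => y13.
rewrite -E1 in T1 T3; rewrite -E2 in T2 T4.
have pV3 : p \in V3 by rewrite [p]surjective_pairing [p.2]surjective_pairing !in_setX V1 V2 V3'.
move/negP: nXp; apply; rewrite /X !in_setU.
have [e|e|e|[v [v0 ev1 ev2 ev3]]] :=
  three_points G1 G1' G1'' G2 G3 t0 t1 t1' t1'' t2 t3 T1 T2 T3 T4 y12 y13 y23.
- by rewrite [p \in X1]inE pV3 e eqxx.
- by rewrite [p \in X2]inE pV3 e eqxx !orbT.
- by rewrite [p \in X3]inE pV3 e eqxx !orbT.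
rewrite [p \in X4]inE pV3 orbC; apply/orP; left; have [o oP] := eigen_pt S v0.
by apply/existsP; exists o; rewrite !oP.
Qed.

End LarsenPink.

(** * Centralizers and escape from degenerate traces *)

Definition quad_roots (F : finFieldType) (p q : F) := [set z : F | z ^+ 2 + p * z + q == 0].

Lemma card_quad_roots (F : finFieldType) (p q : F) : (#|quad_roots p q| <= 2)%N.
Proof.
have [->|[z0]] := set_0Vmem (quad_roots p q); first by rewrite cards0.
rewrite inE => /eqP E0; apply: (@leq_trans #|[set z0; - p - z0]|).
  apply/subset_leq_card/subsetP => z; rewrite !inE => /eqP E.
  have /eqP : (z - z0) * (z - (- p - z0)) = 0.
    transitivity ((z ^+ 2 + p * z + q) - (z0 ^+ 2 + p * z0 + q)); first by ring.
    by rewrite E E0 subrr.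
  by rewrite mulf_eq0 !subr_eq0.
by rewrite cards2; case: (_ != _).
Qed.

Section Centralizers.
Variables (F : finFieldType) (S : sl2_model F).
Implicit Types (g h x y : S) (t : F).

(* The traceless part of g up to scaling: it vanishes exactly on scalar matrices. *)
Definition off g : F * F * F := (e12 g, e21 g, e11 g - e22 g).

Definition scale3 (b : F) (o : F * F * F) : F * F * F := (b * o.1.1, b * o.1.2, b * o.2).

Lemma off_neq0 g : g \in mG S -> tr g ^+ 2 != 4%:R -> off g != 0.
Proof.
move=> /SL2P dg; apply: contraNneq => -[g12 g21 /eqP]; rewrite subr_eq0 => /eqP g11.
apply/eqP; transitivity (4%:R * (e11 g * e22 g - e12 g * e21 g)); last by rewrite dg mulr1.
by rewrite /tr g12 g21 g11; ring.
Qed.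

(** Commuting means that the cross product of the vectors [off h] and [off x] vanishes; a nonzero
    coordinate of [off h] gives the ratio. *)
Lemma commute_off h x : off h != 0 -> commute h x -> exists b, off x = scale3 b (off h).
Proof.
move=> h0 hx.
have E11 : e11 (h * x)%g = e11 (x * h)%g by rewrite hx.
have E12 : e12 (h * x)%g = e12 (x * h)%g by rewrite hx.
have E21 : e21 (h * x)%g = e21 (x * h)%g by rewrite hx.
rewrite !entM in E11 E12 E21.
have C1 : e12 h * e21 x = e12 x * e21 h.
  by apply: (addrI (e11 h * e11 x)); rewrite E11; ring.
have C2 : e12 h * (e11 x - e22 x) = e12 x * (e11 h - e22 h).
  apply/eqP; rewrite -subr_eq0; apply/eqP.
  transitivity ((e11 x * e12 h + e12 x * e22 h) - (e11 h * e12 x + e12 h * e22 x)).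
    by ring.
  by rewrite E12 subrr.
have C3 : e21 h * (e11 x - e22 x) = e21 x * (e11 h - e22 h).
  apply/eqP; rewrite -subr_eq0; apply/eqP.
  transitivity ((e21 h * e11 x + e22 h * e21 x) - (e21 x * e11 h + e22 x * e21 h)).
    by ring.
  by rewrite E21 subrr.
rewrite /off /scale3 /=.
have [h12|h12] := eqVneq (e12 h) 0; last first.
  exists (e12 x / e12 h); congr (_, _, _); first by rewrite divfK.
    by apply: (mulfI h12); rewrite C1; field.
  by apply: (mulfI h12); rewrite C2; field.
have [h21|h21] := eqVneq (e21 h) 0; last first.
  exists (e21 x / e21 h); congr (_, _, _); last 1 first.
  - by apply: (mulfI h21); rewrite C3; field.
  - by apply: (mulIf h21); rewrite -C1; field.
  - by rewrite divfK.
have hd : e11 h - e22 h != 0 by apply: contraNneq h0 => hd; rewrite /off h12 h21 hd.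
exists ((e11 x - e22 x) / (e11 h - e22 h)); congr (_, _, _); last by rewrite divfK.
  by apply: (mulIf hd); rewrite -C2 h12 !(mul0r, mulr0).
by apply: (mulIf hd); rewrite -C3 h21 !(mul0r, mulr0).
Qed.

Lemma off_commute x y h b c : off x = scale3 b (off h) -> off y = scale3 c (off h) -> commute x y.
Proof.
move=> [x1 x2 x3] [y1 y2 y3].
have x3' : e11 x = e22 x + b * (e11 h - e22 h) by rewrite -x3; ring.
have y3' : e11 y = e22 y + c * (e11 h - e22 h) by rewrite -y3; ring.
by apply: GL2_eqP; rewrite !entM ?x1 ?x2 ?y1 ?y2 ?x3' ?y3'; ring.
Qed.

Lemma cent1_eq h h' : off h != 0 -> off h' != 0 -> commute h h' ->
  ('C[h] = 'C[h'])%g.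
Proof.
move=> h0 h'0 hh'; apply/setP => x; apply/cent1P/cent1P => xh.
  have [b bP] := commute_off h0 (commute_sym xh); have [c cP] := commute_off h0 hh'.
  exact: off_commute bP cP.
have [b bP] := commute_off h'0 (commute_sym xh); have [c cP] := commute_off h'0 (commute_sym hh').
exact: off_commute bP cP.
Qed.

(** Once [off x] is given, the determinant condition is a monic quadratic equation in [e11 x]. *)
Lemma card_off_fibre (o : F * F * F) : (#|[set x in mG S | off x == o]| <= 2)%N.
Proof.
case: o => [[o1 o2] o3]; apply: leq_trans (card_quad_roots (- o3) (- (1 + o1 * o2))).
rewrite -(card_in_imset (f := e11)).
  apply/subset_leq_card/subsetP => _ /imsetP[x /setIdP[/SL2P dx /eqP[<- <- <-]] ->].
  by rewrite inE -dx; apply/eqP; ring.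
move=> x y /setIdP[_ /eqP[x1 x2 x3]] /setIdP[_ /eqP[y1 y2 y3]] e.
apply: GL2_eqP; rewrite ?x1 ?x2 ?y1 ?y2 //; apply: oppr_inj; apply: (addrI (e11 x)).
by rewrite x3 e y3.
Qed.

Lemma card_cent1 h : off h != 0 -> (#|'C_(mG S)[h]%g| <= 2 * #|F|)%N.
Proof.
move=> h0; pose Y := [set scale3 b (off h) | b : F].
apply: leq_trans (_ : 2 * #|Y| <= _)%N; last by rewrite leq_mul2l leq_imset_card.
apply: (leq_card_fibres (f := off)) => [x /setIP[_ /cent1P xh]|o _].
  by have [b ->] := commute_off h0 (commute_sym xh); apply/imsetP; exists b.
apply: leq_trans (card_off_fibre o).
by apply/subset_leq_card/subsetP => x /setIdP[/setIP[Gx _] xo]; rewrite inE Gx.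
Qed.

(** tr^2 - 4 is the discriminant, a quadratic form in [off]. Thus [off x = b * off h] gives tr(x)^2
    - 4 = b^2 (tr(h)^2 - 4): at most two values of [b], each with at most two [x]. *)
Lemma card_cent1_tr h t : h \in mG S -> tr h ^+ 2 != 4%:R ->
  (#|[set x in 'C_(mG S)[h]%g | tr x == t]| <= 4)%N.
Proof.
move=> Gh th; have h0 := off_neq0 Gh th.
pose Bs := quad_roots 0 (- ((t ^+ 2 - 4%:R) / (tr h ^+ 2 - 4%:R))).
pose Y := [set scale3 b (off h) | b in Bs].
apply: leq_trans (_ : 2 * #|Y| <= 4)%N; last first.
  have := leq_imset_card (fun b => scale3 b (off h)) Bs; rewrite -/Y.
  have := card_quad_roots 0 (- ((t ^+ 2 - 4%:R) / (tr h ^+ 2 - 4%:R))); rewrite -/Bs; lia.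
apply: (leq_card_fibres (f := off)) => [x /setIdP[/setIP[Gx /cent1P xh] /eqP tx]|o _].
  have [b bP] := commute_off h0 (commute_sym xh); rewrite bP; apply/imsetP; exists b => //.
  have th0 : tr h ^+ 2 - 4%:R != 0 by rewrite subr_eq0.
  rewrite inE mul0r addr0 subr_eq0; apply/eqP/(mulIf th0); rewrite divfK // -tx.
  have disc g : g \in mG S -> tr g ^+ 2 - 4%:R = (off g).2 ^+ 2 + 4%:R * ((off g).1.1 * (off g).1.2).
    move=> /SL2P dg; transitivity (tr g ^+ 2 - 4%:R * (e11 g * e22 g - e12 g * e21 g)).
      by rewrite dg mulr1.
    by rewrite /tr /off /=; ring.
  by rewrite !disc // bP /scale3 /=; ring.
apply: leq_trans (card_off_fibre o).
by apply/subset_leq_card/subsetP => x /setIdP[/setIdP[/setIP[Gx _] _] xo]; rewrite inE Gx.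
Qed.

Definition good_tr t := (t != 0) && (t ^+ 2 != 4%:R).

Lemma card_cent1_bad h : h \in mG S -> tr h ^+ 2 != 4%:R ->
  (#|[set x in 'C_(mG S)[h]%g | ~~ good_tr (tr x)]| <= 12)%N.
Proof.
move=> Gh th; set X := [set x in _ | _].
have sub : X \subset [set x in 'C_(mG S)[h]%g | tr x == 0] :|:
   ([set x in 'C_(mG S)[h]%g | tr x == 2%:R] :|: [set x in 'C_(mG S)[h]%g | tr x == - 2%:R]).
  apply/subsetP => x; rewrite !in_setU => /setIdP[Cx]; rewrite /good_tr negb_and !negbK => tx.
  apply/orP; case/orP: tx => tx; [left | right]; first by rewrite inE Cx.
  have : (tr x - 2%:R) * (tr x + 2%:R) == 0.
    by move: tx; rewrite -subr_eq0; congr (_ == 0); ring.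
  rewrite mulf_eq0 subr_eq0 addr_eq0 => /orP[]t2; apply/orP; [left | right]; by rewrite inE Cx.
apply: leq_trans (subset_leq_card sub) _.
rewrite -[12%N]/(4 + (4 + 4))%N.
apply: leq_trans (leq_card_setU _ _) (leq_add (card_cent1_tr _ Gh th) _).
exact: leq_trans (leq_card_setU _ _) (leq_add (card_cent1_tr _ Gh th) (card_cent1_tr _ Gh th)).
Qed.

End Centralizers.

Section Escape.
Variables (F : finFieldType) (S : sl2_model F) (B : {set S}).
Hypotheses (B1 : 1%g \in B) (genB : <<B>>%g = mG S).
Implicit Types (g h x y : S) (t : F).

(* Transposed, so that tr (x * y) is the scalar product of erow x and trow y. *)
Definition trow x : 'rV[F]_4 := row4 (e11 x) (e21 x) (e12 x) (e22 x).
Definition erow x : 'rV[F]_4 := row4 (e11 x) (e12 x) (e21 x) (e22 x).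

Lemma tr_row x y : trow y *m (erow x)^T = (tr (x * y)%g)%:M.
Proof. by rewrite row4_dot; congr (_%:M); rewrite /tr !entM; ring. Qed.

Lemma erow_inj x y : erow x = erow y -> x = y.
Proof.
move=> /rowP E; move: (E 0) (E 1) (E 2) (E 3); rewrite !mxE /= => E0 E1 E2 E3.
exact: GL2_eqP.
Qed.

Definition right_mx y : 'M[F]_4 := \matrix_(i, j)
  nth 0 (nth [::] [:: [:: e11 y; 0; e12 y; 0]; [:: 0; e11 y; 0; e12 y];
                      [:: e21 y; 0; e22 y; 0]; [:: 0; e21 y; 0; e22 y]] i) j.

Lemma trowM x y : trow (x * y)%g = trow x *m right_mx y.
Proof.
apply/rowP => j; rewrite !mxE !big_ord_recl big_ord0 !mxE !entM.
by case: j => -[|[|[|[|//]]]] j4 /=; ring.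
Qed.

Definition span_pow k : 'M[F]_(#|(B ^+ k)%g|, 4) :=
  \matrix_(i < #|(B ^+ k)%g|) trow (enum_val i).

Lemma span_powP k x : x \in (B ^+ k)%g -> (trow x <= span_pow k)%MS.
Proof.
move=> Bx; have -> : trow x = row (enum_rank_in Bx x) (span_pow k).
  by rewrite rowK enum_rankK_in.
exact: row_sub.
Qed.

Lemma span_pow_min k m (E : 'M[F]_(m, 4)) :
  (forall x, x \in (B ^+ k)%g -> (trow x <= E)%MS) -> (span_pow k <= E)%MS.
Proof. by move=> H; apply/row_subP => i; rewrite rowK H ?enum_valP. Qed.

Lemma span_pow_le i j : (i <= j)%N -> (span_pow i <= span_pow j)%MS.
Proof.
move=> ij; apply: span_pow_min => x Bx; apply: span_powP.
exact: subsetP (expgB_le B1 ij) x Bx.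
Qed.

Lemma span_pow_stable k j : (span_pow k.+1 <= span_pow k)%MS -> (span_pow (k + j) <= span_pow k)%MS.
Proof.
move=> st; elim: j => [|j IHj]; first by rewrite addn0.
apply: span_pow_min => x; rewrite addnS expgSr => /mulsgP[y b By Bb ->].
rewrite trowM; apply: submx_trans (submxMr _ (submx_trans (span_powP By) IHj)) _.
apply: submx_trans st; apply/row_subP => i; rewrite row_mul rowK -trowM.
by apply: span_powP; rewrite expgSr mem_mulg ?enum_valP.
Qed.

(** The identity, the two elementary unipotents with entry 1 and their product already span all
    matrices. *)
Lemma span_pow_full k : (B ^+ k)%g = mG S -> row_full (span_pow k).
Proof.
move=> Bk; rewrite /row_full -mxrank_tr -[_ == _]/(row_free _) -kermx_eq0.
apply/rowV0P => v /sub_kermxP vE.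
have dot x : x \in mG S -> trow x *m v^T = 0.
  rewrite -Bk => /span_powP/submxP[D ->]; rewrite -mulmxA -[span_pow k]trmxK.
  by rewrite -trmx_mul vE trmx0 mulmx0.
have v4 : v = row4 (v 0 0) (v 0 1) (v 0 2) (v 0 3).
  apply/rowP => j; rewrite mxE; case: j => -[|[|[|[|//]]]] j4 /=;
    by congr (v _ _); apply/val_inj.
have d1 : 1 * 1 - 1 * 0 = 1 :> F by ring.
have d2 : 1 * 1 - 0 * 1 = 1 :> F by ring.
have sum0 x : x \in mG S ->
    e11 x * v 0 0 + e21 x * v 0 1 + e12 x * v 0 2 + e22 x * v 0 3 = 0.
  by move/dot => /matrixP/(_ 0 0); rewrite [in v^T]v4 row4_dot !mxE /= mulr1n.
have := sum0 _ (groupM (sl2_in S d1) (sl2_in S d2)); have := sum0 _ (sl2_in S d1).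
have := sum0 _ (sl2_in S d2); have := sum0 _ (group1 _).
rewrite !entM !ent_sl2 // !ent1 v4 {v4 sum0 dot vE}.
move: (v 0 0) (v 0 1) (v 0 2) (v 0 3) => a b c d; rewrite !mxE /=.
move=> E1 E2 E3 E4.
have F1 : a + d = 0 by rewrite -[RHS]E1; ring.
have b0 : b = 0 by rewrite -[RHS]E2; transitivity (b + (a + d)); [rewrite F1 addr0|ring].
have c0 : c = 0 by rewrite -[RHS]E3; transitivity (c + (a + d)); [rewrite F1 addr0|ring].
have a0 : a = 0.
  rewrite -[RHS]E4; transitivity (a + b + c + (a + d)); last by ring.
  by rewrite F1 b0 c0 !addr0.
have d0 : d = 0 by rewrite -F1 a0 add0r.
by apply/rowP => j; rewrite !mxE a0 b0 c0 d0; case: j => -[|[|[|[|//]]]] j4.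
Qed.

(** The spans start in dimension 1 and live in dimension 4, so two consecutive ones agree by step 3;
    from then on they are constant, and some power of [B] is the whole group. *)
Lemma span_pow3_full : row_full (span_pow 3).
Proof.
have [k [k3 st]] : exists k, (k <= 3)%N /\ (span_pow k.+1 <= span_pow k)%MS.
  have [[k k4] /= st | nst] := pickP (fun k : 'I_4 => (span_pow k.+1 <= span_pow k)%MS).
    by exists k.
  suff rk k : (k <= 4)%N -> (k < \rank (span_pow k))%N.
    by have := leq_trans (rk 4 isT) (rank_leq_col _).
  elim: k => [_|k IHk k4].
    rewrite lt0n mxrank_eq0; apply/eqP => E.
    have := span_powP (expgB1 B1 0); rewrite E => /submx0null/rowP/(_ 0).
    by rewrite !mxE ent1 /= => /eqP; rewrite oner_eq0.
  apply: leq_ltn_trans (IHk (ltnW k4)) _; rewrite ltn_neqAle mxrankS ?span_pow_le // andbT.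
  have /negP := nst (Ordinal k4) => /=; move=> H; apply/negP => /eqP E; apply: H.
  by rewrite -(geq_leqif (mxrank_leqif_sup (span_pow_le (leqnSn k)))) E.
have [n Bn] := gen_expgs B; rewrite (setUidPr _) ?sub1set // in Bn.
have sub : (span_pow (k + n) <= span_pow 3)%MS.
  exact: submx_trans (span_pow_stable n st) (span_pow_le k3).
have full : (B ^+ (k + n))%g = mG S.
  apply/setP => x; apply/idP/idP => [|Gx]; first exact: expgB_sub.
  by rewrite -genB Bn in Gx; apply: subsetP Gx; rewrite expgB_le ?leq_addl.
by rewrite -sub1mx; apply: submx_trans sub; rewrite sub1mx span_pow_full.
Qed.

(** Take a basis [b j] of the matrix space inside [B ^+ 3]. The four traces tr(x * b j) determine
    [x]; if all were bad they would lie in {0, 2, -2}, leaving at most 3^4 = 81 elements [x] in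
    [B]. *)
Lemma escape : (81 < #|B|)%N -> exists2 g, g \in (B ^+ 4)%g & good_tr (tr g).
Proof.
move=> B81; apply/exists_inP; apply: contraLR B81 => /exists_inPn bad; rewrite -leqNgt.
have f_full := span_pow3_full; pose f := fullrankfun f_full.
pose b j : S := enum_val (f j); pose D := [set 0; 2%:R; - 2%:R : F].
pose phi x := [ffun j : 'I_4 => tr (x * b j)%g].
have phi_inj : injective phi.
  move=> x y /ffunP E; apply: erow_inj; apply: trmx_inj.
  have full : row_full (rowsub f (span_pow 3)) by exact: fullrowsub_full.
  apply: (row_full_inj full); apply/row_matrixP => j.
  have Ej : tr (x * b j)%g = tr (y * b j)%g by have := E j; rewrite /phi [LHS]ffunE [in RHS]ffunE.
  by rewrite !row_mul row_rowsub rowK !tr_row Ej.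
rewrite -(card_imset _ phi_inj); apply: (@leq_trans #|ffun_on (mem D)|).
  apply/subset_leq_card/subsetP => _ /imsetP[x Bx ->]; apply/ffun_onP => j; rewrite ffunE.
  have /bad : (x * b j)%g \in (B ^+ 4)%g by rewrite expgS mem_mulg ?enum_valP.
  rewrite /good_tr negb_and !negbK !inE => /orP[->//|].
  rewrite -subr_eq0 (_ : _ - _ = (tr (x * b j)%g - 2%:R) * (tr (x * b j)%g + 2%:R)); last by ring.
  by rewrite mulf_eq0 subr_eq0 addr_eq0 => /orP[]->; rewrite ?orbT.
rewrite card_ffun_on card_ord -[81%N]/(3 ^ 4)%N leq_exp2r //.
by apply: leq_trans (leq_card_setU _ _) _; rewrite cards1 cards2; case: (_ != _).
Qed.

End Escape.

(** * Rich centralizers *)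

Lemma geq_card_fibres (T1 T2 : finType) (X : {set T1}) (Y : {set T2}) (f : T1 -> T2) k :
    (forall x, x \in X -> f x \in Y) ->
    (forall y, y \in Y -> k <= #|[set x in X | f x == y]|)%N ->
  (k * #|Y| <= #|X|)%N.
Proof.
move=> fXY fib; rewrite -[leqRHS]sum1_card (partition_big f (mem Y)) //= mulnC -sum_nat_const.
apply: leq_sum => y Yy; apply: leq_trans (fib y Yy) _.
by rewrite -sum1_card; apply/eq_leq/eq_bigl => x; rewrite inE.
Qed.

(** The last hypothesis gives [L ^ 3 <= 2 * n]. If [v <= 12] or [v <= 7 * L] the claim is direct;
    otherwise each of the last two terms is at most a quarter of [v ^ 3], the second because 4 * 12
    < 7^2. *)
Lemma cubic_bound v n L : (0 < n)%N -> (v ^ 3 <= 2 * n ^ 2 + 3 * v ^ 2 + (2 * L) ^ 2 * (3 * v))%N ->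
  (L * L * L.-1 <= n)%N -> (v ^ 3 <= 12 ^ 3 * n ^ 2)%N.
Proof.
move=> n0 vn Ln; have L3 : (L ^ 3 <= 2 * n)%N.
  case: L Ln {vn} => [|[|L]] //= Ln; first by lia.
  by apply: leq_trans (leq_mul (leqnn 2) Ln); nia.
have [v12|v12] := leqP v 12.
  by apply: leq_trans (leq_pmulr _ _); rewrite ?leq_exp2r // expn_gt0 n0.
have [v7|v7] := leqP v (7 * L).
  have : (v ^ 3 <= (7 * L) ^ 3)%N by rewrite leq_exp2r.
  rewrite expnMn => v7'; apply: leq_trans v7' _.
  apply: leq_trans (leq_mul (leqnn _) L3) _.
  have : (n <= n ^ 2)%N by rewrite -mulnn leq_pmulr.
  nia.
have h1 : (4 * (3 * v ^ 2) <= v ^ 3)%N by rewrite expnSr; nia.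
have h2 : (4 * ((2 * L) ^ 2 * (3 * v)) <= v ^ 3)%N.
  have : (49 * L ^ 2 <= v ^ 2)%N by rewrite -[49%N]/(7 ^ 2)%N -expnMn leq_exp2r // ltnW.
  rewrite expnSr expnMn; nia.
lia.
Qed.

Lemma cancel_square b N c k : (0 < b)%N ->
  (b ^ 3 <= N ^ 3 * (c * (k * b) ^ 2))%N -> (b <= c * k ^ 2 * N ^ 3)%N.
Proof.
move=> b0 H; rewrite -(@leq_pmul2r (b ^ 2)) ?expn_gt0 ?b0 // -expnS.
apply: leq_trans H _; rewrite expnMn; move: (N ^ 3)%N (k ^ 2)%N (b ^ 2)%N => n k2 b2; lia.
Qed.

Section Pivot.
Variables (F : finFieldType) (S : sl2_model F) (B : {set S}) (K : nat).
Hypotheses (B1 : 1%g \in B) (BV : (B^-1 = B)%g) (genB : <<B>>%g = mG S).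
Hypothesis tripling : (#|(B * B * B)%g| <= K * #|B|)%N.
Implicit Types (g h x y : S) (t : F).

(** 8 = 1 + 6 + 1 is the length of a conjugate by [B] of an element of [B ^+ 6]; 50 = 3 * 16 + 2 is
    the length in [card_fixB] for stabilizers in [B ^+ 16]. *)
Lemma card_trace_set_bound t : good_tr t ->
  (#|trace_set B t 8| ^ 3 <= 12 ^ 3 * #|(B ^+ 50)%g| ^ 2)%N.
Proof.
case/andP => t0 t4; pose L := \max_(v : F * F | v != 0) #|fixB B v (8 + 8)|.
have fixL v : v != 0 -> (#|fixB B v (8 + 8)| <= L)%N.
  by move=> v0; rewrite /L (bigD1 v) //= leq_maxl.
have n_gt0 : (0 < #|(B ^+ 50)%g|)%N by apply/card_gt0P; exists 1%g; apply: expgB1.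
apply: (@cubic_bound _ _ L n_gt0).
  apply: leq_trans (larsen_pink_class BV genB t0 t4 fixL) _.
  rewrite !leq_add2r leq_mul2l /= leq_exp2r //.
  by apply: subset_leq_card; apply: expgB_le.
have [v v0 ->] : {v : F * F | v != 0 & L = #|fixB B v (8 + 8)|}.
  apply: eq_bigmax_cond; apply/card_gt0P; exists (1, 0).
  by apply/eqP => -[/eqP]; rewrite oner_eq0.
rewrite (_ : 50 = 3 * (8 + 8) + 2)%N //.
exact: (card_fixB B1 BV genB _ v0).
Qed.

Lemma trC x y : tr (x * y)%g = tr (y * x)%g.
Proof. by rewrite /tr !entM; ring. Qed.

Lemma trJ x y : tr (x ^ y)%g = tr x.
Proof. by rewrite conjgE trC mulgK. Qed.

Definition cent2 h := (B ^+ 2)%g :&: 'C[h]%g.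

(** Orbit-stabilizer for [x |-> h ^ x] on [B]: two elements of a fibre differ by an element of
    [B ^+ 2] centralizing [h]. *)
Lemma card_leq_trace_cent h : h \in (B ^+ 6)%g ->
  (#|B| <= #|cent2 h| * #|trace_set B (tr h) 8|)%N.
Proof.
move=> Bh; apply: (leq_card_fibres (f := fun x => h ^ x)%g) => [x Bx|y _].
  rewrite inE trJ eqxx andbT conjgE (_ : 8 = 1 + 6 + 1)%N //.
  by rewrite mulgA !expgB_mul ?expgB_inv ?expg1.
have [->|[x0 /setIdP[Bx0 /eqP x0y]]] := set_0Vmem [set x in B | h ^ x == y]%g.
  by rewrite cards0.
rewrite -(card_imset _ (mulIg x0^-1%g)).
apply/subset_leq_card/subsetP => _ /imsetP[x /setIdP[Bx /eqP xy] ->].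
rewrite inE (expgB_mul (i := 1)) ?expgB_inv ?expg1 //=.
by rewrite cent1C; apply/cent1P/commgP/conjg_fixP; rewrite conjgM xy -x0y conjgK.
Qed.

(** 98 = 2 * 49, from the square of [#|B ^+ 50| <= K ^ 49 * #|B|]. *)
Let D := (12 ^ 3 * K ^ 98)%N.

Definition rich h := [/\ h \in mG S, good_tr (tr h) & (#|B| <= D * #|cent2 h| ^ 3)%N].

Lemma rich_of_pow6 h : h \in (B ^+ 6)%g -> good_tr (tr h) -> rich h.
Proof.
move=> Bh th; split=> //; first exact: expgB_sub Bh.
have B_gt0 : (0 < #|B|)%N by apply/card_gt0P; exists 1%g.
have V3 := card_trace_set_bound th; have Bc := card_leq_trace_cent Bh.
have B50 := leq_card_expg_sym 48 B1 BV tripling.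
have : (#|B| ^ 3 <= #|cent2 h| ^ 3 * (12 ^ 3 * (K ^ 49 * #|B|) ^ 2))%N.
  apply: leq_trans (_ : (#|cent2 h| * #|trace_set B (tr h) 8|) ^ 3 <= _)%N.
    by rewrite leq_exp2r.
  rewrite expnMn leq_mul2l; apply/orP; right; apply: leq_trans V3 _.
  by rewrite leq_mul2l; apply/orP; right; rewrite leq_exp2r.
rewrite /D (_ : 98 = 49 * 2)%N // expnM; exact: cancel_square.
Qed.

Hypothesis B_large : (D * 24 ^ 3 < #|B|)%N.

Definition good_cent2 h := [set y in cent2 h | good_tr (tr y)].

(** A centralizer has at most 12 elements of trace 0, 2 or -2, so with more than 24 elements in
    [cent2 h] at least half are good; [B_large] is set for this. *)
Lemma card_good_cent2 h : rich h -> (24 < #|cent2 h|)%N /\ (#|cent2 h| <= 2 * #|good_cent2 h|)%N.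
Proof.
case=> Gh /andP[_ th] ch.
have N24 : (24 < #|cent2 h|)%N.
  have := leq_trans B_large ch; rewrite ltnNge; apply: contraNltn => N24.
  by rewrite leq_mul2l leq_exp2r // N24 orbT.
split=> //; rewrite -(cardsID [set y | good_tr (tr y)] (cent2 h)).
have -> : cent2 h :&: [set y | good_tr (tr y)] = good_cent2 h.
  by apply/setP => y; rewrite [LHS]inE [RHS]inE; congr andb; rewrite inE.
have bad : (#|cent2 h :\: [set y | good_tr (tr y)]| <= 12)%N.
  apply: leq_trans (card_cent1_bad Gh th); apply/subset_leq_card/subsetP => y.
  move=> /setDP[/setIP[By Cy] ty].
  have {}ty : ~~ good_tr (tr y) by move: ty; rewrite inE.
  by apply/setIdP; split=> //; apply/setIP; split=> //; apply: expgB_sub By.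
move: N24; rewrite -(cardsID [set y | good_tr (tr y)] (cent2 h)).
have -> : cent2 h :&: [set y | good_tr (tr y)] = good_cent2 h.
  by apply/setP => y; rewrite [LHS]inE [RHS]inE; congr andb; rewrite inE.
move: bad; move: #|cent2 h :\: _| #|good_cent2 h| => p q; clear; lia.
Qed.

(** [h] may be far from every short power of [B], but its rich centralizer contains a good [h'] in
    [B ^+ 2]. Then [h' ^ b] lies in [B ^+ 4], hence is rich, and it has the same centralizer as
    [h ^ b]. *)
Lemma richJ h b : rich h -> b \in B -> rich (h ^ b)%g.
Proof.
move=> rh Bb; have [N24 Nh] := card_good_cent2 rh; have [Gh th ch] := rh.
have [h'] : exists h', h' \in good_cent2 h by apply/set0Pn; rewrite -card_gt0; move: N24 Nh; clear; case: #|good_cent2 h|; lia.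
move=> /setIdP[/setIP[Bh' Ch'] th'].
have Gb : b \in mG S by rewrite -genB mem_gen.
have Bh'b : (h' ^ b)%g \in (B ^+ 6)%g.
  rewrite conjgE mulgA; apply: subsetP (expgB_le B1 (_ : 1 + 2 + 1 <= 6)%N) _ _ => //.
  by rewrite !expgB_mul ?expgB_inv ?expg1.
have [_ _ c'] := rich_of_pow6 Bh'b (etrans (congr1 _ (trJ _ _)) th').
split; [by rewrite groupJ | by rewrite trJ |].
have Gh' : h' \in mG S by apply: expgB_sub Bh'.
suff -> : cent2 (h ^ b)%g = cent2 (h' ^ b)%g by [].
rewrite /cent2 (@cent1_eq _ _ (h ^ b)%g (h' ^ b)%g) //.
- by apply: off_neq0; [rewrite groupJ | rewrite trJ; case/andP: th].
- by apply: off_neq0; [rewrite groupJ | rewrite trJ; case/andP: th'].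
by rewrite /commute -!conjMg; congr (_ ^ _)%g; apply/cent1P; rewrite cent1C.
Qed.

Lemma rich_class h x : rich h -> x \in mG S -> rich (h ^ x)%g.
Proof.
rewrite -genB => rh Bx; move: x Bx h rh.
apply: gen_sym_ind => [h rh|b x Bb IH h rh]; first by rewrite conjg1.
by rewrite conjgM; apply: IH; apply: richJ.
Qed.

(** Double counting of the pairs of a conjugate [h] of [h0] and a good [y] in [cent2 h]. Each [h]
    has at least [m] partners, with [#|B| <= 8 * D * m ^ 3]; each [y] has at most 4, being the
    elements of trace [tr h0] in its centralizer. So [m * #|Cl| <= 4 * K * #|B|], and
    [#|G| <= 2 * #|F| * #|Cl|]. *)
Lemma pivot : (81 < #|B|)%N ->
  (#|mG S| ^ 3 <= 16 ^ 3 * #|F| ^ 3 * D * K ^ 3 * #|B| ^ 2)%N.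
Proof.
move=> B81; have [h0 Bh0 th0] := escape B1 genB B81.
have rh0 : rich h0.
  by apply: rich_of_pow6 th0; apply: subsetP (expgB_le B1 (_ : 4 <= 6)%N) _ Bh0.
have [Gh0 _ _] := rh0; have /andP[_ th04] := th0.
pose Cl := (h0 ^: mG S)%g.
have richCl h : h \in Cl -> rich h by case/imsetP => x Gx ->; apply: rich_class.
have [hm Clm hmin] := arg_minnP (fun h => #|good_cent2 h|) (class_refl (mG S) h0).
set m := #|good_cent2 hm| in hmin.
have B_gt0 : (0 < #|B|)%N by apply/card_gt0P; exists 1%g.
have hmB : (#|B| <= 8 * D * m ^ 3)%N.
  have [_ _ ch] := richCl hm Clm; have [_ N2] := card_good_cent2 (richCl hm Clm).
  apply: leq_trans ch _; rewrite (mulnC 8) -mulnA leq_mul2l; apply/orP; right.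
  have : (#|cent2 hm| ^ 3 <= (2 * m) ^ 3)%N by rewrite leq_exp2r.
  by rewrite expnMn.
pose Q := [set p : S * S | (p.1 \in Cl) && (p.2 \in good_cent2 p.1)].
have QP h y : (h, y) \in Q -> [/\ h \in Cl, y \in (B ^+ 2)%g, y \in 'C[h]%g & good_tr (tr y)].
  by case/setIdP => Clh /setIdP[/setIP[By Cy] ty].
have lowQ : (m * #|Cl| <= #|Q|)%N.
  apply: (geq_card_fibres (f := fun p => p.1)) => [[h y] /QP[]//|h Clh].
  apply: leq_trans (hmin h Clh) _; rewrite -(card_imset _ (fun y y' => @congr1 _ _ snd (h, y) (h, y'))).
  apply/subset_leq_card/subsetP => _ /imsetP[y Cy ->].
  by apply/setIdP; split=> //; apply/setIdP.
have uppQ : (#|Q| <= 4 * #|(B ^+ 2)%g|)%N.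
  apply: (leq_card_fibres (f := fun p => p.2)) => [[h y] /QP[]//|y By].
  have [->|[[h1 y1] /setIdP[/QP[_ _ _ ty1] /eqP/= e1]]] := set_0Vmem [set p in Q | p.2 == y].
    by rewrite cards0.
  have Gy := expgB_sub genB By; rewrite e1 in ty1; have /andP[_ ty] := ty1.
  apply: leq_trans (card_cent1_tr (tr h0) Gy ty).
  rewrite -(card_in_imset (f := fst)).
    apply/subset_leq_card/subsetP => _ /imsetP[[h y2] /setIdP[/QP[Clh _ Ch _] /eqP/= e2] ->] /=.
    case/imsetP: (Clh) => x Gx hx; rewrite e2 in Ch.
    apply/setIdP; split; last by rewrite hx trJ.
    by apply/setIP; split; [rewrite hx groupJ | rewrite cent1C].
  by move=> [h2 y2] [h3 y3] /setIdP[_ /eqP/= ->] /setIdP[_ /eqP/= ->] /= ->.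
have B2 := leq_card_expg_sym 0 B1 BV tripling; rewrite expn1 in B2.
have cG : (#|mG S| <= 2 * #|F| * #|Cl|)%N.
  rewrite /Cl -index_cent1 -(Lagrange (subcent1_sub h0 (mG S))) leq_mul2r.
  by rewrite card_cent1 ?orbT // off_neq0.
have mCl : (m * #|Cl| <= 4 * (K * #|B|))%N.
  by apply: leq_trans lowQ (leq_trans uppQ _); rewrite leq_mul2l.
have Cl3 : (#|Cl| ^ 3 <= 8 * D * (4 * K) ^ 3 * #|B| ^ 2)%N.
  rewrite -(leq_pmul2r B_gt0); apply: leq_trans (leq_mul (leqnn _) hmB) _.
  have : ((m * #|Cl|) ^ 3 <= (4 * (K * #|B|)) ^ 3)%N by rewrite leq_exp2r.
  move/(leq_mul (leqnn (8 * D))); rewrite !expnMn [(#|B| ^ 3)%N]expnSr.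
  move: (m ^ 3)%N (#|Cl| ^ 3)%N (K ^ 3)%N (#|B| ^ 2)%N #|B| => x y z w b; lia.
apply: leq_trans (_ : (2 * #|F| * #|Cl|) ^ 3 <= _)%N; first by rewrite leq_exp2r.
rewrite expnMn; apply: leq_trans (leq_mul (leqnn _) Cl3) _.
by rewrite !expnMn; move: (#|F| ^ 3)%N (K ^ 3)%N (#|B| ^ 2)%N => f k b; lia.
Qed.

End Pivot.

(** * Quasirandomness *)

Section Spectral.
Local Open Scope sesquilinear_scope.
Variables (N d : nat) (T : 'M[algC]_N).

Let H := T *m T^t*.
Let P := spectralmx H.
Let D := spectral_diag H.

Definition sqnorm n (u : 'rV[algC]_n) : algC := (u *m u^t*) 0 0.

Lemma sqnormE n (u : 'rV[algC]_n) : sqnorm u = \sum_i `|u 0 i| ^+ 2.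
Proof. by rewrite /sqnorm !mxE; apply: eq_bigr => i _; rewrite !mxE normCK. Qed.

Lemma gram_normal : H \is normalmx.
Proof.
have HC : H^t* = H by rewrite /H trmx_mul map_mxM trmxCK.
by apply/normalmxP; rewrite HC.
Qed.

Lemma gramE : H = invmx P *m diag_mx D *m P.
Proof. exact/orthomx_spectralP/gram_normal. Qed.

Lemma P_unitary : P \is unitarymx. Proof. exact: spectral_unitarymx. Qed.

Lemma sqnorm_unitary (u : 'rV[algC]_N) : sqnorm (u *m P^t*) = sqnorm u.
Proof.
rewrite /sqnorm trmx_mul map_mxM trmxCK mulmxA.
by rewrite mulmxKtV // P_unitary.
Qed.

Lemma gram_form (u : 'rV[algC]_N) :
  sqnorm (u *m T) = \sum_i D 0 i * `|(u *m P^t*) 0 i| ^+ 2.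
Proof.
rewrite /sqnorm trmx_mul map_mxM mulmxA -(mulmxA u T) -/H gramE.
rewrite invmx_unitary ?P_unitary // -!mulmxA.
rewrite -[P *m u^t*]trmxCK trmx_mul map_mxM trmxCK mulmxA mulmxA.
set y := u *m P^t*; rewrite mul_mx_diag mxE; apply: eq_bigr => i _.
by rewrite !mxE normCK mulrAC mulrC mulrA.
Qed.

Lemma sqnorm_ge0 n (u : 'rV[algC]_n) : 0 <= sqnorm u.
Proof. by rewrite sqnormE sumr_ge0 // => i _; rewrite exprn_ge0. Qed.

Lemma gram_diag_ge0 i : 0 <= D 0 i.
Proof.
have -> : D 0 i = sqnorm (delta_mx 0 i *m P *m T).
  rewrite gram_form -mulmxA (unitarymxP P_unitary) mulmx1 (bigD1 i) //= big1 => [|j ji].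
    by rewrite mxE !eqxx normr1 expr1n mulr1 addr0.
  by rewrite mxE (negPf ji) andbF normr0 expr0n mulr0.
exact: sqnorm_ge0.
Qed.

Lemma gram_trace : \sum_i D 0 i = \sum_i \sum_j `|T i j| ^+ 2.
Proof.
transitivity (\tr H).
  rewrite gramE mxtrace_mulC mulmxA mulmxV ?spectral_unit // mul1mx.
  by rewrite mxtrace_diag.
rewrite /H /mxtrace; apply: eq_bigr => i _; rewrite mxE; apply: eq_bigr => j _.
by rewrite !mxE normCK.
Qed.

Definition gram_diag_eq (l : algC) := [set i | D 0 i == l].

(** In the orthonormal eigenbasis, vectors of the eigenspace are supported on the coordinates where
    [D] equals [l]. *)
Lemma gram_eigenspace_rank (l : algC) : (\rank (eigenspace H l) <= #|gram_diag_eq l|)%N.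
Proof.
pose E := eigenspace H l *m P^t*; pose X := gram_diag_eq l.
have rkE : \rank E = \rank (eigenspace H l).
  by rewrite mxrankMfree // /row_free -invmx_unitary ?P_unitary // mxrank_unit // unitmx_inv spectral_unit.
have ED : E *m diag_mx D = l *: E.
  have /eigenspaceP HE : (eigenspace H l <= eigenspace H l)%MS by [].
  rewrite /E -invmx_unitary ?P_unitary // scalemxAl -HE gramE.
  by rewrite !mulmxA mulmxK ?spectral_unit.
have E0 i j : j \notin X -> E i j = 0.
  rewrite inE => Dj; have /matrixP/(_ i j) := ED.
  rewrite mul_mx_diag !mxE => /eqP; rewrite mulrC -subr_eq0 -mulrBl mulf_eq0 subr_eq0.
  by rewrite (negPf Dj) => /eqP.
rewrite -rkE; pose pr : 'M[algC]_(#|X|, N) := \matrix_(k < #|X|) delta_mx 0 (enum_val k).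
apply: leq_trans (_ : \rank pr <= _)%N; last exact: rank_leq_row.
apply: mxrankS; apply/row_subP => i.
have -> : row i E = \sum_(j in X) E i j *: (delta_mx 0 j : 'rV_N).
  rewrite [LHS]row_sum_delta [RHS]big_mkcond /=; apply: eq_bigr => j _; rewrite mxE.
  by case: ifPn => // /(E0 i) ->; rewrite scale0r.
apply: summx_sub => j Xj; apply: scalemx_sub.
by rewrite -(enum_rankK_in Xj Xj) -(rowK (fun k => delta_mx 0 (enum_val k)) _) row_sub.
Qed.

Hypothesis rank_ge : forall l, l != 0 -> eigenspace H l != 0 ->
  (d <= \rank (eigenspace H l))%N.

(** A nonzero eigenvalue occurs at least [d] times on the diagonal, whose entries are all
    nonnegative. *)
Lemma gram_diag_le i : d%:R * D 0 i <= \sum_j D 0 j.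
Proof.
have [->|Di0] := eqVneq (D 0 i) 0.
  by rewrite mulr0 sumr_ge0 // => j _; apply: gram_diag_ge0.
have eig : eigenspace H (D 0 i) != 0.
  apply/eqP => E0; have : delta_mx 0 i *m P = 0 :> 'rV_N.
    apply/eqP; rewrite -submx0 -E0; apply/eigenspaceP.
    rewrite gramE !mulmxA mulmxK ?spectral_unit // scalemxAl; congr (_ *m P).
    apply/rowP => j; rewrite mul_mx_diag !mxE eqxx /=.
    by case: eqP => [->|]; rewrite ?mulr1 ?mul1r // mulr0 mul0r.
  move/(congr1 (mulmx^~ (P^t*))); rewrite -mulmxA (unitarymxP P_unitary) mulmx1 mul0mx.
  by move/rowP/(_ i); rewrite !mxE !eqxx => /eqP; rewrite oner_eq0.
have dk := leq_trans (rank_ge Di0 eig) (gram_eigenspace_rank _).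
apply: le_trans (_ : #|gram_diag_eq (D 0 i)|%:R * D 0 i <= _).
  by rewrite ler_wpM2r ?gram_diag_ge0 // ler_nat.
rewrite (bigID (mem (gram_diag_eq (D 0 i)))) /=.
rewrite (eq_bigr (fun=> D 0 i)) => [|j]; last by rewrite inE => /eqP.
rewrite sumr_const mulr_natl lerDl sumr_ge0 // => j _; exact: gram_diag_ge0.
Qed.

Lemma spectral_gap (u : 'rV[algC]_N) :
  d%:R * sqnorm (u *m T) <= (\sum_i \sum_j `|T i j| ^+ 2) * sqnorm u.
Proof.
rewrite gram_form -gram_trace -(sqnorm_unitary u) sqnormE !mulr_sumr.
apply: ler_sum => i _; rewrite mulrA ler_wpM2r ?exprn_ge0 //; exact: gram_diag_le.
Qed.

End Spectral.

Section Quasirandom.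
Local Open Scope sesquilinear_scope.
Variables (gT : finGroupType) (G : {group gT}).
Implicit Types (A : {set gT}) (x y g : gT).

Let N := #|G|.
Let idx := gring_index G.

Definition density A : algC := #|A|%:R / N%:R.

(** Row vectors are functions on [G], acted on by convolution with the indicator of [A]; subtracting
    the density makes constants map to 0. *)
Definition conv_mx A : 'M[algC]_N :=
  \matrix_(i, j) ((enum_val j * (enum_val i)^-1 \in A)%g%:R - density A).

Lemma N_neq0 : N%:R != 0 :> algC.
Proof. by rewrite pnatr_eq0 -lt0n cardG_gt0. Qed.

Lemma density_real A : density A \is Num.real.
Proof. by rewrite realM ?realV ?realn. Qed.

Lemma conv_mxV A : (conv_mx A)^t* = conv_mx A^-1%g.
Proof.
apply/matrixP => i j; rewrite !mxE rmorphB /= (CrealP (density_real A)) conjC_nat.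
by rewrite /density card_invg inE invMg invgK.
Qed.

(** The entry depends only on the quotient of the two group elements, which a common right
    translation preserves. *)
Lemma conv_mx_comm A x : x \in G -> comm_mx (conv_mx A) (regular_repr algC G x).
Proof.
move=> Gx; apply/matrixP => i k; rewrite !mxE.
have Gi (j : 'I_N) : enum_val j \in G by apply: enum_valP.
have aGE (j l : 'I_N) : regular_repr algC G x j l = (l == idx (enum_val j * x)%g)%:R.
  by rewrite /= /regular_mx !mxE eqxx.
pose j0 := idx (enum_val k * x^-1)%g; pose i0 := idx (enum_val i * x)%g.
rewrite (bigD1 j0) //= big1 ?addr0 => [|j jj0]; last first.
  rewrite aGE; case: eqP => [kE|_]; last by rewrite mulr0.
  case/eqP: jj0; rewrite /j0 kE gring_indexK ?groupM // mulgK.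
  exact/esym/gring_valK.
rewrite aGE gring_indexK ?groupM ?groupV // mulgKV /idx gring_valK eqxx mulr1.
rewrite (bigD1 i0) //= big1 ?addr0 => [|j ji0]; last first.
  by rewrite aGE (negPf ji0) mul0r.
rewrite aGE eqxx mul1r !mxE !gring_indexK ?groupM ?groupV // invMg.
by rewrite !mulgA.
Qed.

Lemma sum_conv A (g : gT) : A \subset G -> g \in G ->
  \sum_(i < N) (g * (enum_val i)^-1 \in A)%g%:R = #|A|%:R :> algC.
Proof.
move=> AG Gg; rewrite -natr_sum; congr (_%:R).
pose X := [set i : 'I_N | (g * (enum_val i)^-1 \in A)%g].
transitivity #|X|.
  by rewrite -sum1_card [RHS]big_mkcond; apply: eq_bigr => i _; rewrite inE; case: (_ \in A).
rewrite -(card_in_imset (f := fun i => (g * (enum_val i)^-1)%g)) => [|i j _ _ /mulgI/invg_inj]; last first.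
  exact: enum_val_inj.
apply: eq_card => a; apply/imsetP/idP => [[i /[!inE] Ai ->] //|Aa].
have Ga := subsetP AG a Aa.
exists (idx (a^-1 * g)%g); rewrite ?inE gring_indexK ?groupM ?groupV // invMg invgK mulKVg //.
Qed.

Lemma const_conv A : A \subset G -> (const_mx 1 : 'rV_N) *m conv_mx A = 0.
Proof.
move=> AG; apply/rowP => k; rewrite !mxE.
transitivity (\sum_(i < N) (enum_val k * (enum_val i)^-1 \in A)%g%:R - \sum_(i < N) density A).
  by rewrite -sumrB; apply: eq_bigr => i _; rewrite !mxE mul1r.
rewrite sum_conv ?enum_valP // sumr_const card_ord -[_ *+ N]mulr_natr.
by rewrite /density divfK ?N_neq0 // subrr.
Qed.

Lemma row_regular (v : 'rV[algC]_N) x (j : 'I_N) : x \in G ->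
  (v *m regular_repr algC G x) 0 (idx (enum_val j * x)%g) = v 0 j.
Proof.
move=> Gx; have Gi (l : 'I_N) : enum_val l \in G by apply: enum_valP.
rewrite mxE (bigD1 j) //= big1 ?addr0 => [|l lj]; rewrite /regular_mx !mxE eqxx /=.
  by rewrite eqxx mulr1.
case: eqP => [E|_]; last by rewrite mulr0.
case/eqP: lj; apply: enum_val_inj; apply: (mulIg x).
by have := congr1 enum_val E; rewrite !gring_indexK ?groupM.
Qed.

Lemma sum_sqr_conv A : A \subset G ->
  \sum_i \sum_j `|conv_mx A i j| ^+ 2 <= (N * #|A|)%:R.
Proof.
move=> AG; have AVG : (A^-1)%g \subset G by rewrite -(invGid G) invSg.
have -> : (N * #|A|)%:R = \sum_(i < N) #|A|%:R :> algC.
  by rewrite sumr_const card_ord -mulrnA mulnC.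
apply: ler_sum => i _; set r := density A.
have r0 : 0 <= r by rewrite divr_ge0.
have -> : \sum_j `|conv_mx A i j| ^+ 2 =
    \sum_(j < N) ((enum_val i * (enum_val j)^-1 \in A^-1)%g%:R * (1 - r *+ 2) + r ^+ 2).
  apply: eq_bigr => j _; rewrite mxE -/r real_normK; last by rewrite realB ?realn // density_real.
  rewrite inE invMg invgK; case: (_ \in A); rewrite ?mul1r ?mul0r /=; ring.
rewrite big_split /= -mulr_suml sum_conv ?enum_valP // card_invg sumr_const card_ord.
have rN : r * N%:R = #|A|%:R by rewrite /r /density divfK ?N_neq0.
rewrite -[X in _ + X]mulr_natr expr2 -[X in _ + X]mulrA rN.
rewrite (_ : _ + _ = #|A|%:R - r * #|A|%:R); last by ring.
by rewrite gerBl mulr_ge0.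
Qed.

(* Every nonzero eigenvalue of the Gram matrix of conv_mx A has multiplicity at least d,
   so it is at most 1/d times the trace; this contradicts the value of the image of the indicator
   of A at the elements a^-1 * g, which lie outside A * A. *)
Theorem quasirandom d A g :
    (forall n (rG : mx_representation algC G n), (n < d)%N -> G \subset rker rG) ->
    A \subset G -> g \in G -> g \notin (A * A * A)%g ->
  (d * #|A| ^ 3 <= N ^ 3)%N.
Proof.
move=> mindeg AG Gg gA.
have [->|[a0 Aa0]] := set_0Vmem A; first by rewrite cards0 muln0.
have A_gt0 : (0 < #|A|)%N by apply/card_gt0P; exists a0.
pose T := conv_mx A; have AVG : (A^-1)%g \subset G by rewrite -(invGid G) invSg.
(* Eigenspaces are submodules of the regular representation. One of dimension below [d] would be
   fixed pointwise, so made of constant functions, which [conv_mx A] kills, against [l != 0]. *)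
have rank_ge l : l != 0 -> eigenspace (T *m T^t*) l != 0 -> (d <= \rank (eigenspace (T *m T^t*) l))%N.
  move=> l0 E0; rewrite leqNgt; apply/negP => rk; set E := eigenspace _ l in E0 rk.
  have modE : mxmodule (regular_repr algC G) E.
    apply/mxmoduleP => x Gx; apply: comm_mx_stable_eigenspace.
    rewrite conv_mxV /comm_mx -mulmxA (conv_mx_comm A^-1%g Gx).
    by rewrite !mulmxA (conv_mx_comm A Gx).
  have := mindeg _ (submod_repr modE) rk; rewrite rker_submod => /subsetP Estab.
  case/rowV0Pn: E0 => v vE v0; case/eqP: v0.
  have vfix x : x \in G -> v *m regular_repr algC G x = v.
    move=> Gx; have := Estab x Gx; rewrite inE Gx /= => /eqP Ex.
    by case/submxP: vE => D ->; rewrite -mulmxA Ex.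
  have vconst : v = v 0 (idx 1%g) *: const_mx 1.
    apply/rowP => k; rewrite !mxE mulr1.
    have Gk : enum_val k \in G by apply: enum_valP.
    have := row_regular v (idx 1%g) Gk; rewrite vfix // gring_indexK // mul1g.
    by rewrite /idx gring_valK.
  move/eigenspaceP: vE; rewrite vconst -!scalemxAl mulmxA const_conv // mul0mx scaler0.
  move/esym/eqP; rewrite scaler_eq0 (negPf l0) /= => /eqP //.
pose u : 'rV[algC]_N := \row_i (enum_val i \in A)%:R.
have Gi (i : 'I_N) : enum_val i \in G by apply: enum_valP.
have nu : sqnorm u = #|A|%:R.
  rewrite sqnormE -card_invg -(sum_conv AVG (group1 G)); apply: eq_bigr => i _.
  by rewrite mxE normr_nat -natrX mul1g memV_invg; case: (_ \in A).
pose Z := [set k : 'I_N | (g * (enum_val k)^-1 \in A)%g].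
have cZ : #|Z|%:R = #|A|%:R :> algC.
  rewrite -(sum_conv AG Gg) -sum1_card natr_sum big_mkcond; apply: eq_bigr => k _.
  by rewrite inE; case: (_ \in A).
have uT k : k \in Z -> (u *m T) 0 k = - (#|A|%:R * density A).
  rewrite inE => Zk; rewrite mxE -card_invg -(sum_conv AVG (group1 G)) mulr_suml -sumrN.
  apply: eq_bigr => i _; rewrite !mxE mul1g memV_invg.
  have [Ai|_] := boolP (enum_val i \in A); last by rewrite !mul0r oppr0.
  rewrite (negPf (_ : (enum_val k * (enum_val i)^-1 \notin A)%g)) ?sub0r ?mul1r //.
  apply: contra gA => Aki.
  rewrite (_ : g = (g * (enum_val k)^-1) * (enum_val k * (enum_val i)^-1) * enum_val i)%g.
    by rewrite !mem_mulg.
  by rewrite !mulgA !mulgKV.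
have low : #|A|%:R * (#|A|%:R * density A) ^+ 2 <= sqnorm (u *m T).
  rewrite sqnormE (bigID (mem Z)) /= -[leLHS]addr0 lerD //; last first.
    by rewrite sumr_ge0 // => i _; rewrite exprn_ge0.
  rewrite (eq_bigr (fun=> (#|A|%:R * density A) ^+ 2)) => [|k /uT ->]; last first.
    by rewrite normrN real_normK // realM ?realn ?density_real.
  by rewrite sumr_const -[X in X * _ <= _]cZ -[leRHS]mulr_natl.
have := spectral_gap rank_ge u; rewrite nu => gap.
have {low gap} : d%:R * (#|A|%:R * (#|A|%:R * density A) ^+ 2) <= (N * #|A|)%:R * #|A|%:R :> algC.
  apply: le_trans (le_trans gap _); first by rewrite ler_wpM2l.
  by rewrite ler_wpM2r ?sum_sqr_conv.
(* The inequality reads d |A|^5 / N^2 <= N |A|^2; this factor clears it to the claim. *)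
have N2 : 0 < N%:R ^+ 2 * #|A|%:R ^- 2 :> algC.
  by rewrite divr_gt0 // exprn_gt0 // ltr0n ?cardG_gt0.
rewrite -(ler_pM2r N2) => H; rewrite -(ler_nat algC).
have A0 : #|A|%:R != 0 :> algC by rewrite pnatr_eq0 -lt0n.
apply: etrans H; congr (_ <= _); rewrite ?[(d * _)%:R]natrM !natrX /density.
  by field; rewrite A0 N_neq0.
by rewrite natrM; field.
Qed.

End Quasirandom.

(** * Unipotent elements and minimal degree *)

Section Unipotent.
Variables (F : finFieldType) (S : sl2_model F).
Implicit Types (g h x y : S) (a b c d s z t : F).

Definition uni z : S := sl2 1 z 0 1.
Definition low z : S := sl2 1 0 z 1.
Definition tor s : S := sl2 s 0 0 s^-1.

Lemma uni_det z : 1 * 1 - z * 0 = 1 :> F. Proof. by ring. Qed.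
Lemma low_det z : 1 * 1 - 0 * z = 1 :> F. Proof. by ring. Qed.
Lemma tor_det s : s != 0 -> s * s^-1 - 0 * 0 = 1 :> F.
Proof. by move=> s0; rewrite mulfV // mulr0 subr0. Qed.

Lemma uni_in z : uni z \in mG S. Proof. exact: sl2_in (uni_det z). Qed.
Lemma low_in z : low z \in mG S. Proof. exact: sl2_in (low_det z). Qed.
Lemma tor_in s : s != 0 -> tor s \in mG S. Proof. by move/tor_det/(sl2_in S). Qed.

Lemma uniM z z' : (uni z * uni z')%g = uni (z + z').
Proof. by apply: GL2_eqP; rewrite !entM !(ent_sl2 _ (uni_det _)); ring. Qed.

Lemma uni0 : uni 0 = 1%g.
Proof. by apply: GL2_eqP; rewrite !(ent_sl2 _ (uni_det _)) ent1. Qed.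

Lemma uniV z : (uni z)^-1%g = uni (- z).
Proof. by apply: (mulgI (uni z)); rewrite mulgV uniM subrr uni0. Qed.

Lemma uni_torJ s z : s != 0 -> (uni z ^ (tor s)^-1)%g = uni (s ^+ 2 * z).
Proof.
move=> s0; rewrite conjgE invgK; apply: (mulIg (tor s)); rewrite -!mulgA mulVg mulg1.
by apply: GL2_eqP; rewrite !entM !(ent_sl2 _ (uni_det _)) !(ent_sl2 _ (tor_det s0)); field.
Qed.

Lemma low_uniJ z : exists2 w, w \in mG S & low z = (uni (- z)%R ^ w)%g.
Proof.
have dw : 0 * 0 - 1 * (-1) = 1 :> F by ring.
exists (sl2 0 1 (-1) 0); first exact: sl2_in dw.
rewrite conjgE; apply: (mulgI (sl2 0 1 (-1) 0)); rewrite mulKVg.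
by apply: GL2_eqP;
  rewrite !entM !(ent_sl2 _ (uni_det _)) !(ent_sl2 _ (low_det _)) !(ent_sl2 _ dw); ring.
Qed.

Lemma big_cell g : g \in mG S -> e21 g != 0 ->
  g = (uni ((e11 g - 1) / e21 g)%R * low (e21 g) * uni ((e22 g - 1) / e21 g)%R)%g.
Proof.
move=> /SL2P dg c0.
apply: GL2_eqP; rewrite !entM !(ent_sl2 _ (uni_det _)) !(ent_sl2 _ (low_det _)); try by field.
by apply: (mulIf c0); rewrite -[LHS]addr0 -(subrr 1) -{1}dg; field.
Qed.

(** The lower unipotents are conjugate to upper ones, so [N] contains the big cell; an element with
    [e21 = 0] enters it after multiplication by [low 1]. *)
Lemma sub_normal_uni (N : {group S}) :
  mG S \subset 'N(N)%g -> (forall z, uni z \in N) -> mG S \subset N.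
Proof.
move=> nN UN; have LN z : low z \in N.
  by have [w Gw ->] := low_uniJ z; rewrite memJ_norm ?UN // (subsetP nN).
have cell g : g \in mG S -> e21 g != 0 -> g \in N.
  by move=> Gg c0; rewrite (big_cell Gg c0) !groupM.
apply/subsetP => g Gg; have [c0|/cell->//] := eqVneq (e21 g) 0.
rewrite -(mulgK (low 1) g) groupM ?groupV //; apply: cell; first by rewrite groupM ?low_in.
have /SL2P dg := Gg; rewrite entM !(ent_sl2 _ (low_det _)) c0 mul0r add0r mulr1.
by apply: contra_eq_neq dg => ->; rewrite c0 !mulr0 subr0 eq_sym oner_neq0.
Qed.

Lemma exists_square_neq1 : (3 < #|F|)%N -> exists2 s : F, s != 0 & s ^+ 2 != 1.
Proof.
move=> q3; pose X := 0 |: quad_roots (0 : F) (-1).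
have cX : (#|X| < #|F|)%N.
  apply: leq_trans q3; rewrite ltnS cardsU1 -[3%N]/(1 + 2)%N leq_add ?card_quad_roots //.
  by case: (_ \notin _).
have [s Xs] : exists s, s \notin X.
  apply/existsP; apply: contraLR cX => /existsPn H; rewrite -leqNgt -cardsT.
  by apply/subset_leq_card/subsetP => s _; rewrite -[_ \in _]negbK H.
move: Xs; rewrite !inE negb_or mul0r addr0 subr_eq0 => /andP[s0 s1].
by exists s.
Qed.

(** The torus scales [uni z] by [s ^+ 2], so if [s ^+ 2 != 1], which needs more than 3 elements in
    [F], every [uni z] is a commutator. *)
Lemma sl2_perfect : (3 < #|F|)%N -> (mG S)^`(1)%g = mG S.
Proof.
move=> /exists_square_neq1[s s0 s1]; apply/eqP; rewrite eqEsubset der_sub /=.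
apply: sub_normal_uni => [|z]; first exact: der_norm.
have s1' : s ^+ 2 - 1 != 0 by rewrite subr_eq0.
have -> : uni z = [~ uni (z / (s ^+ 2 - 1))%R, (tor s)^-1]%g.
  by rewrite commgEl uniV uni_torJ // uniM; congr uni; field.
by rewrite mem_commg ?uni_in ?groupV ?tor_in.
Qed.

Definition unis := [set uni z | z : F].

Lemma unis_group_set : group_set unis.
Proof.
apply/group_setP; split; first by apply/imsetP; exists 0; rewrite ?uni0.
by move=> _ _ /imsetP[z _ ->] /imsetP[z' _ ->]; rewrite uniM imset_f.
Qed.
Canonical unis_group := Group unis_group_set.

Lemma unis_sub : unis_group \subset mG S.
Proof. by apply/subsetP => _ /imsetP[z _ ->]; apply: uni_in. Qed.

Lemma unis_abelian : abelian unis_group.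
Proof.
apply/centsP => _ /imsetP[z _ ->] _ /imsetP[z' _ ->].
by rewrite /commute !uniM addrC.
Qed.

Lemma tor_norm s : s != 0 -> tor s \in 'N(unis_group)%g.
Proof.
move=> s0; rewrite -groupV inE; apply/subsetP => _ /imsetP[_ /imsetP[z _ ->] ->].
by rewrite uni_torJ // imset_f.
Qed.

(* A nontrivial character of the unipotent subgroup occurring in the representation has at
   least (#|F| - 1) / 2 conjugates under the diagonal torus, which all occur as well. *)
Lemma sl2_min_degree n (rG : mx_representation algC (mG S) n) :
  (n < #|F|.-1./2)%N -> mG S \subset rker rG.
Proof.
move=> nq; apply: sub_normal_uni => [|z]; first exact/normal_norm/rker_normal.
apply/negPn/negP => kz; pose psi := 'Res[unis_group] (cfRepr rG).
have Uu (z' : F) : uni z' \in unis_group by apply: imset_f.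
have psiN : psi \is a character by rewrite cfRes_char ?cfRepr_char.
(* If only the principal character occurred, [uni z] would act trivially, contrary to [kz]. *)
have [i ci i0] : exists2 i, i \in irr_constt psi & i != 0.
  apply/exists_inP; apply: contraR kz => /exists_inPn all0.
  rewrite -[_ \in _]/(uni z \in rker rG) -cfker_repr cfkerEchar ?cfRepr_char // inE uni_in /=.
  rewrite -!(cfResE _ unis_sub) ?group1 // -/psi [psi]cfun_sum_constt !sum_cfunE.
  apply/eqP; apply: eq_bigr => i /all0; rewrite negbK => /eqP ->.
  by rewrite irr0 !cfunE !cfun1E !Uu group1.
have lin_i := char_abelianP _ unis_abelian i.
pose J := [set conjg_Iirr i (tor s) | s in [set~ 0]].
have JP j : j \in J -> j \in irr_constt psi.
  case/imsetP => s /[!inE] s0 ->; move: ci; rewrite !irr_consttE conjg_IirrE.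
  have psiJ : (psi ^ tor s)%CF = psi.
    by rewrite /psi cfConjgRes_norm ?cfConjg_id ?tor_in ?tor_norm //
       (subsetP (normG _)) ?tor_in.
  by rewrite -{2}psiJ cfConjg_iso.
(* Twisting by [tor s] rescales the argument by [s ^+ 2]. If two twists agree while the squares
   differ, the character is trivial on all of [F]; so a fibre lies among the two square roots of
   [s' ^+ 2]. *)
have cJ : (#|F|.-1 <= 2 * #|J|)%N.
  rewrite -(cardsC1 (0 : F)).
  apply: (leq_card_fibres (f := fun s => conjg_Iirr i (tor s))) => [s s0|j _].
    exact: imset_f.
  have [->|[s' /setIdP[/[!inE] s'0 /eqP js']]] :=
    set_0Vmem [set s in [set~ 0] | conjg_Iirr i (tor s) == j]; first by rewrite cards0.
  apply: leq_trans (card_quad_roots 0 (- s' ^+ 2)); apply/subset_leq_card/subsetP => s.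
  move=> /setIdP[/[!inE] s0 /eqP js]; rewrite mul0r addr0 subr_eq0.
  apply: contraR i0 => ss'; rewrite -irr_eq1; apply/eqP/cfun_inP => _ /imsetP[x _ ->].
  have s2 : s ^+ 2 - s' ^+ 2 != 0 by rewrite subr_eq0.
  pose y := x / (s ^+ 2 - s' ^+ 2).
  have E : 'chi_i (uni (s ^+ 2 * y)) = 'chi_i (uni (s' ^+ 2 * y)).
    rewrite -!uni_torJ // -!cfConjgE ?tor_norm // -!conjg_IirrE js js' //.
  rewrite cfun1E Uu (_ : x = s ^+ 2 * y + - (s' ^+ 2 * y)); last by rewrite /y; field.
  rewrite -uniM -uniV lin_charM ?groupV ?Uu // lin_charV ?Uu // E mulfV //.
  by rewrite lin_char_neq0 ?Uu.
(* Each constituent in [J] is linear and has multiplicity at least 1. *)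
have : #|J|%:R <= n%:R :> algC.
  rewrite -(cfRepr1 rG) -(cfRes1 unis_group) -/psi [psi]cfun_sum_constt sum_cfunE.
  rewrite -sum1_card natr_sum [leRHS](bigID (mem J)) /= -[leLHS]addr0 lerD //.
    rewrite [leRHS](eq_bigl (mem J)) => [|j]; last first.
      by apply/andP/idP => [[_ //]|Jj]; split=> //; apply: JP.
    apply: ler_sum => j Jj; have cj := JP _ Jj; rewrite cfunE lin_char1 ?mulr1 //; last exact/char_abelianP/unis_abelian.
    move: cj; rewrite irr_consttE; case/natrP: (Cnat_cfdot_char_irr j psiN) => m ->.
    by rewrite pnatr_eq0 -lt0n ler1n.
  apply: sumr_ge0 => j _; rewrite cfunE mulr_ge0 ?natr_ge0 ?Cnat_cfdot_char_irr //.
  exact: Cnat_irr1.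
rewrite ler_nat => Jn; move: nq cJ Jn; move: #|F|.-1 #|J| => q j; clear; lia.
Qed.

End Unipotent.

(** * Growth *)

Lemma pow_bound (a0 a1 a2 a3 i j m k : nat) : (i <= k)%N -> (j * m <= k)%N ->
  exists c, forall K, (0 < K)%N -> (a0 + a1 * K ^ i + a2 * (a3 * K ^ j) ^ m <= c * K ^ k)%N.
Proof.
move=> ik jk; exists (a0 + a1 + a2 * a3 ^ m)%N => K K0.
rewrite expnMn -expnM mulnA !mulnDl.
by rewrite !leq_add ?leq_mul2l ?leq_pexp2l ?orbT // leq_pmulr ?expn_gt0 ?K0.
Qed.

Lemma scale_bound (a c m k : nat) :
  exists c', forall K, (c * (a * K ^ m) ^ k = c' * K ^ (m * k))%N.
Proof. by exists (c * a ^ k)%N => K; rewrite expnMn -expnM mulnA. Qed.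

(** The hypotheses on [d] and [g] give q n^3 <= 4 M q^3 n^2, so n <= 4 M q^2. Then q^9 <= 8 g^3 <=
    128 M^3 q^7 bounds q^2, and 512 = 4 * 128. *)
Lemma combine_bound q d g n M : (0 < n)%N -> (0 < q)%N -> (q <= 4 * d)%N -> (q ^ 3 <= 2 * g)%N ->
  (d * n ^ 3 <= g ^ 3)%N -> (g ^ 3 <= M * q ^ 3 * n ^ 2)%N ->
  (n <= 512 * M ^ 4)%N.
Proof.
move=> n0 q0 qd qg dn gn.
have n2_0 : (0 < n ^ 2)%N by rewrite expn_gt0 n0.
have h1 : (n <= 4 * M * q ^ 2)%N.
  have qn : (0 < q * n ^ 2)%N by rewrite muln_gt0 q0 n2_0.
  rewrite -(leq_pmul2r qn).
  have : (q * n ^ 3 <= 4 * (M * q ^ 3 * n ^ 2))%N.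
    apply: leq_trans (leq_mul qd (leqnn _)) _; rewrite -mulnA leq_mul2l /=.
    exact: leq_trans gn.
  rewrite !expnS !expn0; lia.
have q4_0 : (0 < q ^ 4)%N by rewrite expn_gt0 q0.
have h2 : (q ^ 2 <= 128 * M ^ 3)%N.
  have q7 : (0 < q ^ 7)%N by rewrite expn_gt0 q0.
  rewrite -(leq_pmul2r q7) -expnD.
  have q9 : (q ^ 9 <= 8 * (M * q ^ 3 * n ^ 2))%N.
    rewrite -[9%N]/(3 * 3)%N expnM; apply: leq_trans (_ : (2 * g) ^ 3 <= _)%N.
      by rewrite leq_exp2r.
    by rewrite expnMn leq_mul2l.
  have nn : (n ^ 2 <= (4 * M * q ^ 2) ^ 2)%N by rewrite leq_exp2r.
  apply: leq_trans q9 _; apply: leq_trans (_ : 8 * (M * q ^ 3 * (4 * M * q ^ 2) ^ 2) <= _)%N.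
    by rewrite !leq_mul.
  by rewrite !expnS !expn0; lia.
apply: leq_trans h1 _; apply: leq_trans (leq_mul (leqnn _) h2) _.
by rewrite !expnS !expn0; lia.
Qed.

Section Growth.
Variables (F : finFieldType) (S : sl2_model F).

(** The big cell is parametrized injectively by q (q - 1) q triples, and q <= 2 (q - 1). *)
Lemma card_sl2_ge : (1 < #|F|)%N -> (#|F| ^ 3 <= 2 * #|mG S|)%N.
Proof.
move=> q1; pose f (p : F * (F * F)) : S := (uni S p.1 * low S p.2.1 * uni S p.2.2)%g.
have cX : (#|setX [set: F] (setX [set~ (0%R : F)] [set: F])| <= #|mG S|)%N.
  rewrite -(card_in_imset (f := f)).
    apply/subset_leq_card/subsetP => _ /imsetP[p _ ->].
    by rewrite !groupM ?uni_in ?low_in.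
  have fE p : [/\ e11 (f p) = 1 + p.1 * p.2.1, e21 (f p) = p.2.1 & e22 (f p) = 1 + p.2.1 * p.2.2].
    rewrite /f !entM !(ent_sl2 _ (uni_det _)) !(ent_sl2 _ (low_det _)).
    by split; ring.
  move=> [x [c z]] [x' [c' z']] /setXP[_ /setXP[/= /[!inE] c0 _]] _ E.
  have [/= a1 a2 a3] := fE (x, (c, z)); have [/= b1 b2 b3] := fE (x', (c', z')).
  have cc : c = c' by rewrite -a2 E b2.
  have xx : x = x' by move: a1; rewrite E b1 -cc => /addrI/(mulIf c0).
  have zz : z = z' by move: a3; rewrite E b3 -cc => /addrI/(mulfI c0).
  by rewrite cc xx zz.
move: cX; rewrite !cardsX cardsC1 !cardsT.
by case: #|F| q1 => [//|[//|q]] _ /= cX; rewrite !expnS expn0; nia.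
Qed.

(** The summands cover three cases: [B] too small for [escape], [B] below the threshold of richness,
    and the main case, where 9 = 3^2 comes from [#|B| <= 3 * #|A|] and 101 = 98 + 3. *)
Lemma growth_poly (A : {set S}) K L : L = (27 * K ^ 3)%N -> (3 < #|F|)%N ->
    A \subset mG S -> <<A>>%g = mG S ->
    (0 < #|A|)%N -> (#|(A * A * A)%g| <= K * #|A|)%N -> (A * A * A)%g != mG S ->
  (#|A| <= 81 + 24 ^ 3 * 12 ^ 3 * L ^ 98 + 512 * (9 * 16 ^ 3 * 12 ^ 3 * L ^ 101) ^ 4)%N.
Proof.
move=> LE q3 AG genA A0 trip notG.
have A0' : A != set0 by rewrite -card_gt0.
pose B := sym_hull A; have B1 : 1%g \in B := sym_hull1 A.
have BV : (B^-1)%g = B := sym_hullV A.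
have genB : <<B>>%g = mG S by rewrite gen_sym_hull.
have nB : (#|A| <= #|B|)%N := subset_leq_card (sub_sym_hull A).
have Bn : (#|B| <= 3 * #|A|)%N.
  apply: leq_trans (leq_card_setU _ _) _; rewrite cards1.
  have := leq_card_setU A A^-1%g; rewrite card_invg => H.
  apply: leq_trans (leq_add (leqnn 1) H) _; move: A0; move: #|A| => a; clear; lia.
have Btrip : (#|(B * B * B)%g| <= L * #|B|)%N.
  by apply: leq_trans (card_sym_hull_tripling A0' trip) _; rewrite LE leq_mul2l nB orbT.
set D := (12 ^ 3 * L ^ 98)%N.
have [Bsmall|Blarge] := leqP #|B| (D * 24 ^ 3).
  apply: leq_trans nB (leq_trans Bsmall _); apply: leq_trans (leq_addr _ _).
  by rewrite /D [X in (_ <= _ + X)%N](_ : _ = D * 24 ^ 3)%N ?leq_addl // /D -mulnA mulnC.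
have [B81|B81] := leqP #|B| 81.
  by apply: leq_trans nB (leq_trans B81 _); rewrite -addnA leq_addr.
have piv := pivot B1 BV genB Btrip Blarge B81.
apply: leq_trans (leq_addl _ _).
have [g Gg gA] : exists2 g, g \in mG S & g \notin (A * A * A)%g.
  apply/exists_inP; apply: contraR notG => /exists_inPn H.
  rewrite eqEsubset; apply/andP; split; first by rewrite !mul_subG.
  by apply/subsetP => g Gg; have := H g Gg; rewrite negbK.
have quasi := quasirandom (@sl2_min_degree F S) AG Gg gA.
apply: (combine_bound A0 _ _ (card_sl2_ge _) quasi); try exact: leq_trans q3.
  by move: q3; case: #|F| => // q; clear; lia.
apply: leq_trans piv _; rewrite -/D.
have B2 : (#|B| ^ 2 <= 9 * #|A| ^ 2)%N by rewrite -[9%N]/(3 ^ 2)%N -expnMn leq_exp2r.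
apply: leq_trans (leq_mul (leqnn _) B2) _.
rewrite /D (_ : 101 = 98 + 3)%N // expnD.
move: (16 ^ 3)%N (12 ^ 3)%N (L ^ 98)%N (L ^ 3)%N (#|F| ^ 3)%N (#|A| ^ 2)%N => a b c d e f.
by clear; lia.
Qed.

End Growth.

(** Without growth, [a *: A = A * A = A :* a] for every [a] in [A]. The left stabilizer of [A] is
    then normal with cyclic quotient, so it contains the derived subgroup, here all of [G]. *)
Lemma strict_growth (gT : finGroupType) (G : {group gT}) (A : {set gT}) :
  (G^`(1) = G)%g -> A \subset G -> <<A>>%g = G -> A != set0 ->
  (#|(A * A * A)%g| <= #|A|)%N -> A = G.
Proof.
move=> perfG AG genA /set0Pn[a0 Aa0] small.
have cAA : (#|(A * A)%g| <= #|A|)%N.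
  by apply: leq_trans small; apply: leq_card_mulr Aa0.
have lA a : a \in A -> (a *: A = A * A)%g.
  move=> Aa; apply/eqP; rewrite eqEcard card_lcoset cAA andbT.
  by rewrite mulSg ?sub1set.
have rA a : a \in A -> (A :* a = A * A)%g.
  move=> Aa; apply/eqP; rewrite eqEcard card_rcoset cAA andbT.
  by rewrite mulgS ?sub1set.
pose H := [set x in G | x *: A == A]%g.
have gH : group_set H.
  apply/group_setP; split=> [|x y]; first by rewrite inE group1 lcoset1 eqxx.
  move=> /setIdP[Gx /eqP xA] /setIdP[Gy /eqP yA].
  by rewrite inE groupM //= lcosetM yA xA.
have HG : Group gH \subset G by apply/subsetP => x /setIdP[].
have nHA : A \subset 'N(Group gH)%g.
  apply/subsetP => a Aa; rewrite -groupV inE; apply/subsetP => _ /imsetP[x /setIdP[Gx /eqP xA] ->].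
  have Ga := subsetP AG a Aa.
  have aVA : (a^-1 *: A = A :* a^-1)%g.
    by rewrite -{1}[A](rcosetK a) (rA a Aa) -(lA a Aa) -mulgA lcosetK.
  rewrite inE groupJ ?groupV //= conjgE invgK !lcosetM aVA.
  by rewrite (mulgA _ A) xA -aVA lcosetKV.
have nHG : G \subset 'N(Group gH)%g by rewrite -genA gen_subG.
have GH : G \subset Group gH.
  rewrite -[gval G in X in X \subset _]perfG; apply: der1_min => //.
  (* [A] lies in one coset of the stabilizer: [a *: A = a0 *: A] shows that [a0^-1 * a] stabilizes
     [A]. *)
  have -> : (G / Group gH = <[coset (Group gH) a0]>)%g.
    rewrite -genA quotient_gen // /cycle; congr <<_>>%g; apply/setP => y.
    apply/imsetP/set1P => [[a /setIP[Na Aa] ->]|->]; last first.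
      by exists a0 => //; rewrite inE Aa0 (subsetP nHA).
    have Ga := subsetP AG a Aa; have Ga0 := subsetP AG a0 Aa0.
    have Ha : (a0^-1 * a)%g \in Group gH.
      by rewrite inE groupM ?groupV //= lcosetM lA // -(lA a0 Aa0) lcosetK.
    have N0 := subsetP nHA a0 Aa0; have N1 := subsetP (normG _) _ Ha.
    by rewrite -(mulKVg a0 a) (morphM _ N0 N1) /= (coset_id Ha) mulg1.
  exact: cycle_abelian.
have {}GH : H = G by apply/eqP; rewrite eqEsubset; apply/andP; split.
have GA g : g \in G -> (g *: A = A)%g by rewrite -GH => /setIdP[_ /eqP].
apply/eqP; rewrite eqEsubset AG; apply/subsetP => g Gg.
have Ga0 : (g * a0^-1)%g \in G by rewrite groupM ?groupV // (subsetP AG).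
by rewrite -(GA _ Ga0) -{1}(mulgKV a0 g) mem_mulg ?set11.
Qed.

Lemma card_cosetpre_set (gT : finGroupType) (H : {group gT}) (A : {set coset_of H}) :
  #|(coset H @*^-1 A)%g| = (#|H| * #|A|)%N.
Proof.
have fibre y : y \in A -> [set x in (coset H @*^-1 A)%g | coset H x == y] = y.
  move=> Ay; apply/setP => x; apply/setIdP/idP => [[/morphpreP[Nx _] /eqP <-]|xy].
    by rewrite val_coset ?rcoset_refl.
  have Nx := subsetP (coset_norm y) x xy; have E := coset_mem xy.
  by split; [apply/morphpreP; split; rewrite /= ?E | apply/eqP].
have cy (y : coset_of H) : #|set_of_coset y| = #|H|.
  by case: (cosetP y) => x Nx ->; rewrite val_coset // card_rcoset.
have fA x : x \in (coset H @*^-1 A)%g -> coset H x \in A by case/morphpreP.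
apply/eqP; rewrite eqn_leq; apply/andP; split.
  by apply: leq_card_fibres fA _ => y Ay; rewrite fibre // cy.
by apply: geq_card_fibres fA _ => y Ay; rewrite fibre // cy.
Qed.

Definition growth_at (R : realType) (eps : R) (gT : finGroupType) (G : {set gT}) (A : {set gT}) :=
  Num.min ((#|A|%:R : R) `^ (1 + eps)) #|G|%:R <= #|(A * A * A)%g|%:R.

(** The preimage of [A] multiplies all cardinals by |H|, and it generates [G] because it contains a
    full coset of [H]. Dividing by |H| is harmless since |H|^(1 + eps) >= |H|. *)
Lemma growth_quotient (R : realType) (eps : R) (gT : finGroupType) (G H : {group gT}) :
    0 < eps -> (H <| G)%g ->
    (forall A : {set gT}, A \subset G -> <<A>>%g = G -> growth_at eps G A) ->
  forall A : {set coset_of H}, A \subset (G / H)%g -> <<A>>%g = (G / H)%g ->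
    growth_at eps (G / H)%g A.
Proof.
move=> eps0 nHG growG A AG genA; pose A' := (coset H @*^-1 A)%g.
have A'G : A' \subset G by rewrite sub_cosetpre_quo.
have H_gt0 : 0 < #|H|%:R :> R by rewrite ltr0n.
have H_ge1 : 1 <= #|H|%:R :> R by rewrite ler1n.
have cG : #|G|%:R = #|H|%:R * #|(G / H)%g|%:R :> R.
  by rewrite -natrM -card_cosetpre_set quotientGK.
have [A0|[a Aa]] := set_0Vmem A.
  rewrite /growth_at A0 cards0 powR0 ?gt_eqF ?addr_gt0 //.
  by rewrite ge_min ler0n.
have genA' : <<A'>>%g = G.
  have HA' : H \subset <<A'>>%g.
    have [x Nx xa] := cosetP a; apply/subsetP => h Hh.
    have A'x : x \in A' by apply/morphpreP; split=> //=; rewrite -xa.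
    have A'hx : (h * x)%g \in A'.
      have Nh : h \in 'N(H)%g := subsetP (normG H) h Hh.
      by apply/morphpreP; split; [rewrite groupM | rewrite /= coset_kerl // -xa].
    by rewrite -(mulgK x h) groupM ?groupV ?mem_gen.
  apply/eqP; rewrite eqEsubset gen_subG A'G /=.
  rewrite -(quotientSGK (normal_norm nHG) HA') quotient_gen ?cosetpreK ?genA //.
  by apply: subset_trans A'G (normal_norm nHG).
have := growG A' A'G genA'; rewrite /growth_at -!cosetpreM !card_cosetpre_set !natrM cG.
rewrite powRM ?ler0n //; set x := #|A|%:R; set y := #|(A * A * A)%g|%:R => gr.
rewrite -(ler_pM2l H_gt0); apply: le_trans gr.
rewrite le_min; apply/andP; split; last by rewrite ler_pM2l // ge_min lexx orbT.
apply: le_trans (_ : #|H|%:R * (x `^ (1 + eps)) <= _).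
  by rewrite ler_pM2l // ge_min lexx.
rewrite ler_wpM2r ?powR_ge0 // -[leLHS]powRr1 ?ler0n // ler_powR // lerDl.
exact: ltW.
Qed.

(** For [x > d] one has ln(c + 2) <= (ln x) / 2, and the power inequality gives y >= x^(1 + 1/(2C)).
    For [x <= d] only [y >= x + 1 >= x * (1 + 1/d)] is available, which suffices as eps <= ln(1 +
    1/d) / ln d. Taking c + 2 ensures [d > 1]. *)
Lemma exponent_growth (R : realType) (c C : nat) : (0 < C)%N ->
  exists2 eps : R, 0 < eps & forall x y : nat, (0 < x)%N -> (x < y)%N ->
    (x ^ C.+1 <= c * y ^ C)%N -> (x%:R : R) `^ (1 + eps) <= y%:R.
Proof.
move=> C0; pose d : nat := (c.+2 ^ 2)%N.
have d1 : (1 < d)%N by rewrite /d; nia.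
pose l1 : R := ln (1 + d%:R^-1); pose l2 : R := ln d%:R.
have dR1 : 1 < d%:R :> R by rewrite ltr1n.
have d0 : 0 < d%:R :> R by rewrite (lt_trans _ dR1).
have l1_gt0 : 0 < l1 by rewrite ln_gt0 // ltrDl invr_gt0.
have l2_gt0 : 0 < l2 by rewrite ln_gt0.
have CR0 : 0 < C%:R :> R by rewrite ltr0n.
pose eps : R := Num.min (l1 / l2) (2%:R * C%:R)^-1.
have eps_gt0 : 0 < eps by rewrite lt_min divr_gt0 // invr_gt0 mulr_gt0.
exists eps => // x y x0 xy big.
have xR0 : 0 < x%:R :> R by rewrite ltr0n.
have y0 : (0 < y)%N by apply: leq_trans xy.
have yR0 : 0 < y%:R :> R by rewrite ltr0n.
have lx0 : 0 <= ln (x%:R : R) by rewrite ln_ge0 // ler1n.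
rewrite -ler_ln ?posrE ?powR_gt0 // ln_powR mulrDl mul1r.
have [xd|dx] := leqP x d.
  have le1 : eps * ln x%:R <= l1.
    apply: le_trans (_ : l1 / l2 * l2 <= _); last by rewrite divfK ?gt_eqF.
    apply: ler_pM => //; first exact: ltW.
      by rewrite ge_min lexx.
    by rewrite ler_ln ?posrE // ler_nat.
  apply: le_trans (lerD (lexx _) le1) _.
  rewrite /l1 -lnM ?posrE ?addr_gt0 ?invr_gt0 // ler_ln ?posrE ?mulr_gt0 ?addr_gt0 ?invr_gt0 //.
  rewrite mulrDr mulr1; apply: le_trans (_ : x%:R + 1 <= _); last by rewrite natr1 ler_nat.
  by rewrite lerD2l ler_pdivrMr // mul1r ler_nat.
have h1 : C.+1%:R * ln (x%:R : R) <= ln (c.+2%:R : R) + C%:R * ln (y%:R : R).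
  rewrite !mulr_natl -!lnXn // -lnM ?posrE ?exprn_gt0 ?ltr0n //.
  rewrite ler_ln ?posrE ?mulr_gt0 ?exprn_gt0 ?ltr0n // -!natrX -natrM ler_nat.
  by apply: leq_trans big _; rewrite leq_mul2r; apply/orP; right; lia.
have h2 : 2%:R * ln (c.+2%:R : R) <= ln (x%:R : R).
  by rewrite mulr_natl -lnXn ?ltr0n // ler_ln ?posrE ?exprn_gt0 ?ltr0n // -natrX ler_nat ltnW.
have h3 : C%:R * (eps * ln (x%:R : R)) <= 2^-1 * ln (x%:R : R).
  rewrite mulrA ler_wpM2r // -ler_pdivlMl // -invfM mulrC; by rewrite ge_min lexx orbT.
rewrite -(ler_pM2l CR0) mulrDr; move: h1; rewrite -natr1 mulrDl mul1r.
lra.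
Qed.

(** 404 = 4 * 101 is the degree in the tripling constant of the hull, which is cubic in [K]. With
    [K] the quotient of the cardinals rounded down plus one, [K * #|A| <= 2 * #|A * A * A|] turns
    [#|A| <= c' * K ^ C] into the claim. *)
Lemma growth_power : exists c C, (0 < C)%N /\
  forall (F : finFieldType) (S : sl2_model F) (A : {set S}), (3 < #|F|)%N ->
    A \subset mG S -> <<A>>%g = mG S -> (0 < #|A|)%N -> (A * A * A)%g != mG S ->
  (#|A| ^ C.+1 <= c * #|(A * A * A)%g| ^ C)%N.
Proof.
have [c cP] := @pow_bound 81 (24 ^ 3 * 12 ^ 3) 512 (9 * 16 ^ 3 * 12 ^ 3) 98 101 4 404 isT isT.
have [c' c'P] := scale_bound 27 c 3 404.
exists (c' * 2 ^ (3 * 404))%N, (3 * 404)%N; split=> // F S A q3 AG genA A0 notG.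
have C0 : (0 < 3 * 404)%N by [].
move: c'P C0; move: (3 * 404)%N => C c'P C0.
pose K := (#|(A * A * A)%g| %/ #|A|).+1.
have tripK : (#|(A * A * A)%g| <= K * #|A|)%N by apply/ltnW/ltn_ceil.
have Kn : (K * #|A| <= 2 * #|(A * A * A)%g|)%N.
  rewrite mul2n -addnn /K mulSn leq_add ?leq_trunc_div //.
  have [a Aa] := card_gt0P A0; apply: leq_trans (leq_card_mulr _ Aa).
  exact: leq_card_mulr Aa.
have nK : (#|A| <= c' * K ^ C)%N.
  apply: leq_trans (growth_poly erefl q3 AG genA A0 tripK notG) _.
  by rewrite -c'P; apply: cP; rewrite muln_gt0 expn_gt0.
rewrite expnS; apply: leq_trans (leq_mul nK (leqnn _)) _.
rewrite -mulnA -expnMn -mulnA -expnMn leq_mul2l; apply/orP; right.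
by rewrite leq_exp2r.
Qed.

Lemma growth_model (R : realType) : exists2 eps : R, 0 < eps &
  forall (F : finFieldType) (S : sl2_model F) (A : {set S}), (3 < #|F|)%N ->
    A \subset mG S -> <<A>>%g = mG S -> growth_at eps (mG S) A.
Proof.
have [c [C [C0 growC]]] := growth_power.
have [eps eps0 epsP] := exponent_growth R c C0.
exists eps => // F S A q3 AG genA; rewrite /growth_at ge_min.
have [->|notG] := eqVneq (A * A * A)%g (mG S); first by rewrite lexx orbT.
have [A0|A0] := posnP #|A|.
  by rewrite A0 powR0 ?ler0n // gt_eqF // addr_gt0.
apply/orP; left; apply: epsP => //; last exact: growC.
(* The strict inequality handles small [A], where the power bound is vacuous. *)
rewrite ltnNge; apply: contra notG => small.
have AE : A = mG S.
  by apply: strict_growth small; rewrite ?sl2_perfect // -card_gt0.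
by rewrite AE !mulGid.
Qed.

(** * SL2 inside the general linear group as an instance of the model *)

Section Instance.
Variable F : finFieldType.
Implicit Types (g h : {'GL_2[F]}) (a b c d : F).

Let gl11 g : F := GLval g 0 0.
Let gl12 g : F := GLval g 0 1.
Let gl21 g : F := GLval g 1 0.
Let gl22 g : F := GLval g 1 1.

Lemma GL2_entry_inj g h :
  gl11 g = gl11 h -> gl12 g = gl12 h -> gl21 g = gl21 h -> gl22 g = gl22 h -> g = h.
Proof.
move=> E11 E12 E21 E22; apply/val_inj/matrixP => i j.
have I2 (k : 'I_2) : k = 0 \/ k = 1.
  by case: k => -[|[|//]] k2; [left | right]; apply/val_inj.
by case: (I2 i) => ->; case: (I2 j) => ->.
Qed.

Lemma GL2_entryM g h :
  [/\ gl11 (g * h)%g = gl11 g * gl11 h + gl12 g * gl21 h,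
      gl12 (g * h)%g = gl11 g * gl12 h + gl12 g * gl22 h,
      gl21 (g * h)%g = gl21 g * gl11 h + gl22 g * gl21 h &
      gl22 (g * h)%g = gl21 g * gl12 h + gl22 g * gl22 h].
Proof.
rewrite /gl11 /gl12 /gl21 /gl22 GL_ME.
by split; rewrite mxE !big_ord_recl big_ord0 addr0; congr (_ * _ + _ * _);
  congr (GLval _ _ _); apply/val_inj.
Qed.

Lemma GL2_entry1 : [/\ gl11 1%g = 1, gl12 1%g = 0, gl21 1%g = 0 & gl22 1%g = 1].
Proof. by rewrite /gl11 /gl12 /gl21 /gl22 GL_1E !mxE. Qed.

Lemma GL2_det g : \det (GLval g) = gl11 g * gl22 g - gl12 g * gl21 g.
Proof.
rewrite (expand_det_row _ 0) !big_ord_recl big_ord0 addr0 /cofactor !det_mx11 !mxE.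
rewrite /gl11 /gl12 /gl21 /gl22 expr0 mul1r expr1 mulN1r mulrN.
by congr (_ * _ - _ * _); congr (GLval _ _ _); apply/val_inj.
Qed.

Lemma GL2_SL2P g : reflect (gl11 g * gl22 g - gl12 g * gl21 g = 1) (g \in SL2_group F).
Proof. by rewrite inE GL2_det; apply: eqP. Qed.

Definition mx2 a b c d : 'M[F]_2 :=
  \matrix_(i < 2, j < 2) if i == 0 then if j == 0 then a else b
                          else if j == 0 then c else d.

(** The default value 1 is returned when the matrix is singular. *)
Definition GL2_of a b c d : {'GL_2[F]} := insubd (1%g : {'GL_2[F]}) (mx2 a b c d).

Lemma GL2_entry_of a b c d : a * d - b * c = 1 ->
  [/\ gl11 (GL2_of a b c d) = a, gl12 (GL2_of a b c d) = b,
      gl21 (GL2_of a b c d) = c & gl22 (GL2_of a b c d) = d].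
Proof.
move=> det1; have VM : GLval (GL2_of a b c d) = mx2 a b c d.
  apply: insubdK; rewrite unfold_in /= unitmxE (expand_det_row _ 0).
  rewrite !big_ord_recl big_ord0 addr0 /cofactor !det_mx11 !mxE /=.
  by rewrite expr0 mul1r expr1 mulN1r mulrN det1 unitr1.
by rewrite /gl11 /gl12 /gl21 /gl22 VM !mxE.
Qed.

Definition SL2_model : sl2_model F :=
  SL2Model GL2_entry_inj GL2_entryM GL2_entry1 GL2_SL2P GL2_entry_of.

End Instance.

Theorem theorem2p2p1 (R : realType) :
  exists2 eps : R, 0 < eps &
    forall F : finFieldType, (3 < #|F|)%N ->
      (forall A : {set {'GL_2[F]}},
         A \subset SL2 F -> <<A>>%g = SL2 F ->
         Num.min ((#|A|%:R : R) `^ (1 + eps)) #|SL2 F|%:R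
           <= #|(A * A * A)%g|%:R)
      /\
      (forall A : {set coset_of 'Z(SL2 F)},
         A \subset PSL2 F -> <<A>>%g = PSL2 F ->
         Num.min ((#|A|%:R : R) `^ (1 + eps)) #|PSL2 F|%:R
           <= #|(A * A * A)%g|%:R).
Proof.
have [eps eps0 growS] := growth_model R; exists eps => // F q3.
have growSL A := growS F (SL2_model F) A q3.
by split; [exact: growSL | exact: growth_quotient eps0 (center_normal _) growSL].
Qed.
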